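(* For every integer $k \geq 2$, $\mathrm{NTIME}(2^{(k+\frac{1}{2})n}) \subseteq \textsc{Spec}_{2k+2}$.
   Context: For a positive integer $N$, $\mathsf{BINARY}(N)$ is its binary representation, and for $A\subseteq \mathbb{N}^+$, $\mathsf{BINARY}(A)$ is the set of binary representations of elements of $A$. For a function $T:\mathbb{N}\to\mathbb{N}$, $\mathrm{NTIME}(T(n))$ denotes the class of sets $A$ of positive integers such that $\mathsf{BINARY}(A)$ is accepted by a non-deterministic (possibly multi-tape) Turing machine running in time $O(T(n))$, where $n$ is the length of the input. First-order sentences are over finite relational vocabularies, with equality. For a first-order sentence $\Phi$, $\textsc{Spec}(\Phi)$ is the set of positive integers $n$ such that $\Phi$ has a model with universe of cardinality exactly $n$. For $k\geq1$, $\textsc{Spec}_k$ is the class of all $\textsc{Spec}(\Phi)$ with $\Phi$ a first-order sentence using at most $k$ distinct variables (variables may be reused). *)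

(* Defs.v *)
From HB Require Import structures.
From mathcomp Require Import all_boot all_order all_algebra.
From mathcomp Require Import all_classical all_reals all_analysis.

Set Implicit Arguments.
Unset Strict Implicit.
Unset Printing Implicit Defensive.

Import Order.TTheory GRing.Theory Num.Theory.
Import numFieldNormedType.Exports.

Local Open Scope classical_set_scope.

(* Most significant digit first and no leading zero when 0 < N: the digit of
   weight 2 ^ i is the parity of N %/ 2 ^ i, and trunc_log 2 N is the largest e
   such that 2 ^ e <= N. *)
Definition binary (N : nat) : seq bool :=
  [seq odd (N %/ 2 ^ i) | i <- rev (iota 0 (trunc_log 2 N).+1)].

Inductive move := Left | Stay | Right.

(* Tapes are semi-infinite to the right, with cells numbered from 0. There are
   [extra_tapes M] tapes besides the input tape, which is tape ord0 and is
   writable. In [delta q a q' b d], [a] lists the scanned symbols, [b] the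
   symbols written in their place and [d] the head moves. *)
Record ntm := NTM {
  extra_tapes : nat;
  state : finType;
  symbol : finType;
  blank : symbol;
  digit : bool -> symbol;
  digit_inj : injective digit;
  digit_blank : forall b, digit b != blank;
  start : state;
  accepting : pred state;
  delta : state -> ('I_extra_tapes.+1 -> symbol) ->
          state -> ('I_extra_tapes.+1 -> symbol) ->
          ('I_extra_tapes.+1 -> move) -> Prop
}.

Record config (M : ntm) := Config {
  cstate : state M;
  chead : 'I_(extra_tapes M).+1 -> nat;
  ctape : 'I_(extra_tapes M).+1 -> nat -> symbol M
}.

Definition initial (M : ntm) (w : seq bool) : config M :=
  @Config M (start M) (fun=> 0)
    (fun i p => if i == ord0 then nth (blank M) (map (@digit M) w) p
                else blank M).

(* A head asked to move left from cell 0 stays there. *)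
Definition moved (d : move) (p : nat) : nat :=
  match d with Left => p.-1 | Stay => p | Right => p.+1 end.

Definition step (M : ntm) (c c' : config M) : Prop :=
  exists q' b d,
    delta (cstate c) (fun i => ctape c i (chead c i)) q' b d /\
    c' = @Config M q' (fun i => moved (d i) (chead c i))
           (fun i p => if p == chead c i then b i else ctape c i p).

Fixpoint steps (M : ntm) (m : nat) (c c' : config M) : Prop :=
  if m is m'.+1 then exists2 c1, step c c1 & steps m' c1 c' else c = c'.

Definition accepts (M : ntm) (w : seq bool) : Prop :=
  exists m c, steps m (initial M w) c /\ accepting (cstate c).

(* The bound is on every computation on every input, accepting or not. *)
Definition runs_in_time (M : ntm) (t : nat -> nat) : Prop :=
  forall w m c, steps m (initial M w) c -> m <= t (size w).

(* The bounding function is real-valued, so that 2 ^ ((k + 1/2) n) needs no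
   rounding. *)
Definition NTIME (R : realType) (T : nat -> R) : set (set nat) :=
  [set A | (forall N, A N -> 0 < N) /\
     exists (M : ntm) (t : nat -> nat),
       [/\ [set w | accepts M w] = binary @` A,
           runs_in_time M t &
           (fun n => ((t n)%:R)%R : R) =O_\oo T]].

Record vocabulary := Vocabulary {
  rel_symbol : finType;
  arity : rel_symbol -> nat;
  arity_gt0 : forall s, 0 < arity s
}.

(* Variables are natural numbers and may be bound several times. *)
Inductive formula (V : vocabulary) : Type :=
| Eq of nat & nat
| Rel (s : rel_symbol V) of (arity s).-tuple nat
| Not of formula V
| And of formula V & formula V
| Or of formula V & formula V
| Exists of nat & formula V
| Forall of nat & formula V.

Fixpoint vars (V : vocabulary) (f : formula V) : seq nat :=
  match f with
  | Eq x y => [:: x; y]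
  | Rel s xs => tval xs
  | Not g => vars g
  | And g h | Or g h => vars g ++ vars h
  | Exists x g | Forall x g => x :: vars g
  end.

Fixpoint free_vars (V : vocabulary) (f : formula V) : seq nat :=
  match f with
  | Eq x y => [:: x; y]
  | Rel s xs => tval xs
  | Not g => free_vars g
  | And g h | Or g h => free_vars g ++ free_vars h
  | Exists x g | Forall x g => [seq y <- free_vars g | y != x]
  end.

Definition sentence (V : vocabulary) (f : formula V) : Prop :=
  free_vars f = [::].

Definition num_vars (V : vocabulary) (f : formula V) : nat :=
  size (undup (vars f)).

Record structure (V : vocabulary) := Structure {
  universe : finType;
  interp : forall s : rel_symbol V, (arity s).-tuple universe -> Prop
}.

Definition update (U : Type) (e : nat -> U) (x : nat) (a : U) : nat -> U :=
  fun y => if y == x then a else e y.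

Fixpoint sat (V : vocabulary) (S : structure V) (e : nat -> universe S)
    (f : formula V) : Prop :=
  match f with
  | Eq x y => e x = e y
  | Rel s xs => interp (map_tuple e xs)
  | Not g => ~ sat e g
  | And g h => sat e g /\ sat e h
  | Or g h => sat e g \/ sat e h
  | Exists x g => exists a, sat (update e x a) g
  | Forall x g => forall a, sat (update e x a) g
  end.

Definition model (V : vocabulary) (S : structure V) (f : formula V) : Prop :=
  forall e : nat -> universe S, sat e f.

Definition Spec (V : vocabulary) (f : formula V) : set nat :=
  [set n | 0 < n /\ exists S : structure V, #|universe S| = n /\ model S f].

Definition SPEC (k : nat) : set (set nat) :=
  [set A | exists (V : vocabulary) (f : formula V),
     [/\ sentence f, num_vars f <= k & A = Spec f]].

(* Main.v *)
(* In a structure with [N] elements, [2 k + 1] elements index [N ^ (2 k + 1)]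
   cells, and this is the size, up to a constant factor, of the space-time
   tableau of a machine running in time [N ^ (k + 1/2)]: [k] elements are the
   base-[N] digits of the time, [k] elements those of the position, and one
   element codes a pair [(a, b)] of numbers below [s], where [s * s <= N], which
   are the high digits of the time and of the position. The constant factor goes
   into the relation symbols, which are indexed by two further digits [j] and
   [l]. The sentence guesses the tableau, a linear order, the coding of the pairs
   and the prefixes of the binary notation of [N]. Local consistency compares a
   cell with the cells at the next time or position; their coordinates are
   reached by changing one digit at a time with the help of a single further
   variable, which makes [2 k + 2] variables in all. *)
From HB Require Import structures.
Require Import Defs.
From mathcomp Require Import all_boot all_order all_algebra.
From mathcomp Require Import all_classical all_reals all_analysis.
From mathcomp Require Import zify.

Set Implicit Arguments.
Unset Strict Implicit.
Unset Printing Implicit Defensive.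

(** The two inclusions are asymmetric. A tableau of any positive side whose local conditions hold
    contains an accepting computation, so the number [s] of values of a high digit is deliberately
    left free: the axioms only give [0 < s] and, as the pairing is injective, [s * s <= N]. The time
    bound serves to build a model, where [s] is the integer square root of [N] and the computation
    is sure to stop inside the square. The obstacle is that a cell occupies [2 k + 1] variables
    while its neighbours are examined. It is met by rebinding: the condition that defines a new
    digit may quantify again over the coordinates, because their old values return outside its
    scope. [k >= 2] provides the six variables that the axioms use. The prefixes of [N] are there to
    read the input: bit [p] of [N] is the parity of the prefix of length [p + 1]. As ranks lie below
    [N], a prefix is stored as its predecessor. *)

Lemma iff_eq (P Q : Prop) : (P <-> Q) -> P = Q.
Proof. by move=> h; apply/propext. Qed.

(** * Local conditions on a tableau *)

Section Cells.
Variable K : finType.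

(** A modal language between machine and logic: [tableau] is written in it and [translate] turns it
    into first-order formulas. Its modalities only go forwards, since each one is implemented by
    incrementing digits. *)
Inductive cell :=
| Atom of K | Row0 | Col0 | Input of bool
| Next of cell | Rgt of cell
| CNot of cell | CAnd of cell & cell.

Variables (w : seq bool) (T : nat) (Q : K -> nat -> nat -> Prop).

(** [Next] and [Rgt] are strong: they fail at the edge of the square. This forbids transitions in
    the last row, and [Rgt] of a truth tests for a right neighbour. *)
Fixpoint ceval (c : cell) (t p : nat) : Prop :=
  match c with
  | Atom x => Q x t p
  | Row0 => t = 0
  | Col0 => p = 0
  | Input b => p < size w /\ nth false w p = b
  | Next d => t.+1 < T /\ ceval d t.+1 p
  | Rgt d => p.+1 < T /\ ceval d t p.+1
  | CNot d => ~ ceval d t p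
  | CAnd d d' => ceval d t p /\ ceval d' t p
  end.

Definition COr c d := CNot (CAnd (CNot c) (CNot d)).
Definition CImp c d := CNot (CAnd c (CNot d)).
Definition CIff c d := CAnd (CImp c d) (CImp d c).
Definition CTrue := CImp Row0 Row0.
Definition CBool (b : bool) := if b then CTrue else CNot CTrue.
Definition CForall (X : finType) (f : X -> cell) :=
  foldr (fun x c => CAnd (f x) c) CTrue (enum X).
Definition CExists (X : finType) (f : X -> cell) :=
  CNot (CForall (fun x => CNot (f x))).
Arguments COr : simpl never.
Arguments CImp : simpl never.
Arguments CIff : simpl never.
Arguments CTrue : simpl never.
Arguments CBool : simpl never.
Arguments CForall : simpl never.
Arguments CExists : simpl never.

Lemma ceval_or c d t p : ceval (COr c d) t p = (ceval c t p \/ ceval d t p).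
Proof.
rewrite /COr /=; apply: iff_eq.
by have [|] := EM (ceval c t p); have [|] := EM (ceval d t p); tauto.
Qed.

Lemma ceval_imp c d t p : ceval (CImp c d) t p = (ceval c t p -> ceval d t p).
Proof.
by rewrite /CImp /=; apply: iff_eq; have [|] := EM (ceval d t p); tauto.
Qed.

Lemma ceval_iff c d t p : ceval (CIff c d) t p = (ceval c t p <-> ceval d t p).
Proof.
rewrite /CIff /CImp /=; apply: iff_eq.
by have [|] := EM (ceval c t p); have [|] := EM (ceval d t p); tauto.
Qed.

Lemma ceval_and c d t p : ceval (CAnd c d) t p = (ceval c t p /\ ceval d t p).
Proof. by []. Qed.

Lemma ceval_not c t p : ceval (CNot c) t p = (~ ceval c t p).
Proof. by []. Qed.

Lemma ceval_next c t p : ceval (Next c) t p = (t.+1 < T /\ ceval c t.+1 p).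
Proof. by []. Qed.

Lemma ceval_rgt c t p : ceval (Rgt c) t p = (p.+1 < T /\ ceval c t p.+1).
Proof. by []. Qed.

Lemma ceval_row0 t p : ceval Row0 t p = (t = 0).
Proof. by []. Qed.

Lemma ceval_col0 t p : ceval Col0 t p = (p = 0).
Proof. by []. Qed.

Lemma ceval_true t p : ceval CTrue t p = True.
Proof. by apply: iff_eq; rewrite /CTrue ceval_imp; tauto. Qed.

Lemma ceval_bool b t p : ceval (CBool b) t p = b.
Proof.
rewrite /CBool; apply: iff_eq; case: b; rewrite ?ceval_true //.
by rewrite [ceval _ _ _]/(~ ceval CTrue t p) ceval_true; split=> // /(_ I).
Qed.

Lemma ceval_forall (X : finType) (f : X -> cell) t p :
  ceval (CForall f) t p = forall x, ceval (f x) t p.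
Proof.
rewrite /CForall; apply: iff_eq.
have -> : (forall x, ceval (f x) t p) =
    (forall x, x \in enum X -> ceval (f x) t p).
  by apply: iff_eq; split=> h x => [_|]; apply: h; rewrite // mem_enum.
elim: (enum X) => [|x s IH]; first by rewrite [foldr _ _ _]/CTrue ceval_true.
split=> [[hx /IH hs] y|h].
  by rewrite inE => /predU1P[->//|/hs].
split; first by apply: h; rewrite inE eqxx.
by apply/IH => y hy; apply: h; rewrite inE hy orbT.
Qed.

Lemma ceval_exists (X : finType) (f : X -> cell) t p :
  ceval (CExists f) t p = exists x, ceval (f x) t p.
Proof.
rewrite /CExists [LHS]/= ceval_forall; apply: iff_eq; split.
  by move/existsNP => [x /contrapT]; exists x.
by move=> [x hx] /(_ x) /=.
Qed.

Definition cevalE := (ceval_or, ceval_imp, ceval_iff, ceval_and,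
  ceval_not, ceval_next, ceval_rgt, ceval_row0, ceval_col0, ceval_true,
  ceval_bool, ceval_forall, ceval_exists).

End Cells.
Arguments COr : simpl never.
Arguments CImp : simpl never.
Arguments CIff : simpl never.
Arguments CTrue : simpl never.
Arguments CBool : simpl never.
Arguments CForall : simpl never.
Arguments CExists : simpl never.

(** * Computations of a machine as tableaux *)

Definition move_code (d : move) : option bool :=
  match d with Left => Some false | Stay => None | Right => Some true end.
Definition move_decode (o : option bool) : move :=
  match o with Some false => Left | None => Stay | Some true => Right end.
Lemma move_codeK : cancel move_code move_decode.
Proof. by case. Qed.
HB.instance Definition _ := Finite.copy move (can_type move_codeK).

Section Tableau.
Variable M : ntm.
Local Notation tape := 'I_(extra_tapes M).+1.

(** A finite type of candidate transitions, so that the choice among them is a finite disjunction;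
    [valid] selects those that [delta] allows. *)
Definition trans : finType :=
  ((state M * {ffun tape -> symbol M}) *
   (state M * {ffun tape -> symbol M} * {ffun tape -> move}))%type.
Definition valid (tr : trans) : bool :=
  let: (q, a, (q', b, d)) := tr in `[< delta q a q' b d >].

(* The contents of a cell, a relation between times and positions: the state,
   the transition taken ([None] once the computation has stopped), the presence
   of a head on a tape, and the symbol on a tape. The first two are forced not to
   depend on the position by [same_in_row]. *)
Definition kind : finType :=
  ((state M + option trans) + (tape + tape * symbol M))%type.
Definition St q : cell kind := Atom (inl (inl q) : kind).
Definition Halt : cell kind := Atom (inl (inr None) : kind).
Definition Tr tr : cell kind := Atom (inl (inr (Some tr)) : kind).
Definition Hd i : cell kind := Atom (inr (inl i) : kind).
Definition Sy i s : cell kind := Atom (inr (inr (i, s)) : kind).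

Local Notation "c /&\ d" := (CAnd c d) (at level 60, right associativity).
Local Notation "c \|/ d" := (COr c d) (at level 61, right associativity).

(** The guard excludes the last column, where the strong [Rgt] would refute the equivalence for an
    atom that holds. *)
Definition same_in_row (x : kind) : cell kind :=
  CImp (Rgt (CBool kind true)) (CIff (Rgt (Atom x)) (Atom x)).

Definition initial_symbol (i : tape) (s : symbol M) : cell kind :=
  if i == ord0 then
    CExists (fun b => CBool kind (digit M b == s) /&\ Input kind b) \|/
    (CBool kind (s == blank M) /&\ CForall (fun b => CNot (Input kind b)))
  else CBool kind (s == blank M).

(** With no modality to the left, a move to the right is seen diagonally from the cell that the head
    leaves. Column 0 of the next row is nobody's diagonal neighbour and is cleared separately. The
    second disjunct for [Left] is the head that stays at cell 0. *)
Definition head_move (d : move) (i : tape) : cell kind :=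
  match d with
  | Stay => CIff (Next (Hd i)) (Hd i)
  | Right => CImp (Col0 kind) (CNot (Next (Hd i))) /&\
             CIff (Next (Rgt (Hd i))) (Hd i)
  | Left => CIff (Next (Hd i)) (Rgt (Hd i) \|/ (Col0 kind /&\ Hd i))
  end.

Definition tape_step (a b : symbol M) (d : move) (i : tape) : cell kind :=
  CImp (Hd i) (Sy i a) /&\
  CForall (fun s => CIff (Next (Sy i s))
    ((Hd i /&\ CBool kind (s == b)) \|/ (CNot (Hd i) /&\ Sy i s))) /&\
  head_move d i.

Definition trans_step (tr : trans) : cell kind :=
  let: (q, a, (q', b, d)) := tr in
  CBool kind (valid tr) /&\ St q /&\
  CForall (fun q'' => CIff (Next (St q'')) (CBool kind (q'' == q'))) /&\
  CForall (fun i => tape_step (a i) (b i) (d i) i).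

Definition first_row : cell kind :=
  CForall (fun q => CIff (St q) (CBool kind (q == start M))) /&\
  CForall (fun i => CIff (Hd i) (Col0 kind)) /&\
  CForall (fun i => CForall (fun s => CIff (Sy i s) (initial_symbol i s))).

(** A transition needs a next row, so the last row can only halt. [Halt] by itself imposes no link
    with the next row. *)
Definition tableau : cell kind :=
  CForall (fun x : state M + option trans => same_in_row (inl x)) /&\
  CImp (Row0 kind) first_row /&\
  (Halt \|/ CExists (fun tr => Tr tr)) /&\
  CForall (fun q => CImp (Halt /&\ St q) (CBool kind (accepting q))) /&\
  CForall (fun tr => CImp (Tr tr) (trans_step tr)).

Lemma steps_rcons m (c c1 c2 : config M) :
  steps m c c1 -> step c1 c2 -> steps m.+1 c c2.
Proof.
elim: m c => [|m IH] c /=; first by move=> -> h; exists c2.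
by move=> [c' hc h] h'; exists c' => //; apply: IH h h'.
Qed.

Lemma steps_trajectory m (c c' : config M) : steps m c c' ->
  exists f : nat -> config M,
    [/\ f 0 = c, f m = c' & forall t, t < m -> step (f t) (f t.+1)].
Proof.
elim: m c => [|m IH] c /=; first by move=> ->; exists (fun=> c').
move=> [c1 h1 /IH [f [f0 fm hf]]].
exists (fun t => if t is t'.+1 then f t' else c); split=> // -[_|t ht].
  by rewrite f0.
exact: hf.
Qed.

Lemma trajectory_steps (f : nat -> config M) m :
  (forall t, t < m -> step (f t) (f t.+1)) ->
  forall t, t <= m -> steps t (f 0) (f t).
Proof.
move=> hf; elim=> [//|t IH] htm.
by apply: steps_rcons (IH (ltnW htm)) (hf _ htm).
Qed.

(** A head starts at 0 and gains at most one cell per step; hence in every row of the square the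
    scanned cells lie inside the square. *)
Lemma steps_head w m (c : config M) i :
  steps m (initial M w) c -> chead c i <= m.
Proof.
move=> /steps_trajectory [f [f0 <- hf]].
have: m <= m by [].
elim: {1 3 4}m => [|t IH] ht; first by rewrite f0.
have [q' [b [d [_ ->]]]] := hf _ ht.
have /= := IH (ltnW ht); case: (d i) => /=; lia.
Qed.

Section Correct.
Variables (w : seq bool) (T : nat) (Q : kind -> nat -> nat -> Prop).
Local Notation eval := (ceval w T Q).

Definition describes (t : nat) (c : config M) := forall p, p < T ->
  [/\ forall q, eval (St q) t p <-> q = cstate c,
      forall i, eval (Hd i) t p <-> p = chead c i &
      forall i s, eval (Sy i s) t p <-> s = ctape c i p].

Lemma ceval_initial_symbol i s t p : eval (initial_symbol i s) t p <->
  s = ctape (initial M w) i p.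
Proof.
rewrite /initial_symbol [ctape _ _ _]/=; case: ifP => hi; last first.
  by rewrite cevalE; split=> [/eqP|->].
rewrite ceval_or ceval_exists; have [hp|hp] := ltnP p (size w).
  rewrite (nth_map false) //; split=> [[[b]|]|->].
  - by rewrite ceval_and ceval_bool => -[/eqP <- [_ ->]].
  - by rewrite ceval_and ceval_forall => -[_ /(_ (nth false w p))] [].
  by left; exists (nth false w p); rewrite ceval_and ceval_bool.
rewrite nth_default ?size_map //; split=> [[[b]|]|->].
  - by rewrite ceval_and => -[_ []]; lia.
  - by rewrite ceval_and ceval_bool => -[/eqP].
by right; rewrite ceval_and ceval_bool ceval_forall; split=> // b []; lia.
Qed.

Lemma first_row_describes :
  (forall p, p < T -> eval first_row 0 p) <-> describes 0 (initial M w).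
Proof.
split=> h p hp.
  have := h p hp; rewrite /first_row !ceval_and !ceval_forall => -[hq [hH hS]].
  split=> [q|i|i s].
  - by have := hq q; rewrite cevalE cevalE => ->; split=> [/eqP|->].
  - by have := hH i; rewrite cevalE => ->.
  by have := hS i; rewrite ceval_forall => /(_ s); rewrite ceval_iff => ->;
    apply: ceval_initial_symbol.
have [hq hH hS] := h p hp.
rewrite /first_row !ceval_and !ceval_forall; split; last split.
- by move=> q; rewrite ceval_iff hq ceval_bool; split=> [->|/eqP].
- by move=> i; rewrite ceval_iff hH.
move=> i; rewrite ceval_forall => s; rewrite ceval_iff hS.
by symmetry; apply: ceval_initial_symbol.
Qed.

(** The two bounds keep the head off the last column, so that a move to the right has a target
    inside the square. *)
Lemma head_move_describes (d : move) i t h : t.+1 < T -> h <= t ->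
  (forall p, p < T -> (eval (Hd i) t p <-> p = h)) ->
  (forall p, p < T -> eval (head_move d i) t p) <->
  (forall p, p < T -> (eval (Hd i) t.+1 p <-> p = moved d h)).
Proof.
move=> ht hh hH; have hT : h < T by lia.
case: d; split=> H p hp; have := H p hp; rewrite /head_move /moved in H *.
- rewrite !cevalE (hH _ hp).
  have [hp1|hp1] := ltnP p.+1 T; first (rewrite (hH _ hp1) => -[h1 h2]).
    by split=> h3; [have := h1 (conj ht h3)|case: h2 => //]; lia.
  move=> [h1 h2]; split=> h3; first by case: (h1 (conj ht h3)) => -[]; lia.
  by case: h2 => //; right; lia.
- rewrite !cevalE (hH _ hp) => ->.
  have [hp1|hp1] := ltnP p.+1 T; first by rewrite (hH _ hp1); lia.
  by split=> [[_ e]|[[]|[]]]; [right|..]; lia.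
- by rewrite !cevalE (hH _ hp) => <-; tauto.
- by rewrite !cevalE (hH _ hp) => <-; tauto.
- case: p hp => [|p] hp.
    by rewrite !cevalE => -[h1 _]; split=> // h2; case: h1.
  (* The content of column [p.+1] is governed by the condition at column [p], its diagonal
     neighbour. *)
  move=> _; have := H p (ltnW hp).
  rewrite !cevalE (hH _ (ltnW hp)) => -[_ [h1 h2]].
  split=> h3; first by have := h1 (conj ht (conj hp h3)); lia.
  by case: h2 => [|_ []] //; lia.
move=> hp1; rewrite !cevalE hp1 hH //; split; first by move=> ->; lia.
split=> [[_ [hp2]]|e]; first by rewrite H //; lia.
have hp2 : p.+1 < T by lia.
by rewrite H //; lia.
Qed.

Definition apply_trans (q' : state M) (b : {ffun tape -> symbol M})
    (d : {ffun tape -> move}) (c : config M) : config M :=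
  @Config M q' (fun i => moved (d i) (chead c i))
    (fun i p => if p == chead c i then b i else ctape c i p).

(** An equivalence because both inclusions use it: left to right for soundness, right to left for
    completeness. *)
Lemma trans_step_describes q a q' b d t c : t.+1 < T ->
  (forall i, chead c i <= t) -> valid (q, a, (q', b, d)) -> describes t c ->
  (forall p, p < T -> eval (trans_step (q, a, (q', b, d))) t p) <->
  [/\ cstate c = q, forall i, ctape c i (chead c i) = a i &
      describes t.+1 (apply_trans q' b d c)].
Proof.
move=> ht hh hv hc.
have hmove i : (forall p, p < T -> eval (head_move (d i) i) t p) <->
    (forall p, p < T -> (eval (Hd i) t.+1 p <-> p = moved (d i) (chead c i))).
  by apply: head_move_describes => // p /hc [_ h _].
split=> [H|[hq ha hn] p hp].
  split.
  - have T0 : 0 < T by lia.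
    have := H _ T0; rewrite /trans_step !cevalE.
    by case: (hc _ T0) => hq _ _ [_ [/hq -> _]].
  - move=> i; have hp : chead c i < T by have := hh i; lia.
    have := H _ hp; rewrite /trans_step !cevalE => -[_ [_ [_ /(_ i)]]].
    rewrite /tape_step !cevalE; case: (hc _ hp) => _ hH hS [].
    by rewrite hH hS => -> //.
  move=> p hp; have := H _ hp; rewrite /trans_step !cevalE => -[_ [_ [hq hT]]].
  case: (hc _ hp) => _ hH hS.
  split=> [q''|i|i s] /=.
  - have := hq q''; rewrite !cevalE => -[h1 h2].
    by split=> [h|/eqP /h2 []] //; apply/eqP/h1.
  - apply: (proj1 (hmove i)) => // p' hp'; have := H _ hp'.
    by rewrite /trans_step !cevalE => -[_ [_ [_ /(_ i)]]] [_ []].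
  have := hT i; rewrite /tape_step !cevalE => -[_ [/(_ s) + _]].
  rewrite !cevalE hH hS; case: (p =P chead c i) => e [h1 h2]; split=> h.
  - by case: (h1 (conj ht h)) => -[] // _ /eqP.
  - by case: h2 => //; left; rewrite h.
  - by case: (h1 (conj ht h)) => -[].
  by case: h2 => //; right.
case: (hn _ hp) => hq' hH' hS'; case: (hc _ hp) => hq0 hH hS.
rewrite /trans_step !cevalE; split=> //; split; first by rewrite hq0.
split=> [q''|i].
  by rewrite !cevalE hq' /=; split=> [[_ ->]|/eqP ->].
rewrite /tape_step !cevalE hH; split; first by rewrite hS => ->; rewrite ha.
split=> [s|].
  rewrite !cevalE hS' hH hS /=; case: (p =P chead c i) => e; split.
  - by move=> [_ ->]; left.
  - by move=> [[_ /eqP ->]|[]].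
  - by move=> [_ ->]; right.
  by move=> [[]|[_ ->]].
by apply: (proj2 (hmove i)) => // p' /hn [].
Qed.

(** If the machine does not accept, no reached row can halt, so each one carries a transition and
    row [t] describes a configuration reached in [t] steps. The last row, having no successor, gives
    the contradiction. [T] is not related to the running time. *)
Lemma tableau_sound : 0 < T ->
  (forall t p, t < T -> p < T -> eval (tableau) t p) -> accepts M w.
Proof.
move=> T0 H; apply: contrapT => nacc.
(* A transition found in column 0 has to govern the whole row. *)
have const x t : t < T -> forall p, p < T ->
    eval (Atom (inl x)) t 0 <-> eval (Atom (inl x)) t p.
  move=> ht; elim=> [//|p IH] hp.
  have := H t p ht (ltnW hp); rewrite /tableau !ceval_and => -[+ _].
  rewrite ceval_forall => /(_ x); rewrite /same_in_row !cevalE => /(_ (conj hp isT)).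
  by rewrite (IH (ltnW hp)) => -[h1 h2]; split=> [/h2[]|h]; last exact: h1.
suff: forall t, t < T -> exists c, steps t (initial M w) c /\ describes t c.
  move=> /(_ T.-1); have hT : T.-1 < T by lia.
  move=> /(_ hT) [c [hc hd]].
  have := H _ 0 hT T0; rewrite /tableau !ceval_and ceval_or !ceval_forall.
  rewrite ceval_exists => -[_ [_ [[hhalt|[tr htr]] [hacc hstep]]]].
    apply: nacc; exists T.-1, c; split=> //.
    have := hacc (cstate c); rewrite !cevalE; apply; split=> //.
    by case: (hd _ T0) => ->.
  (* A transition in row [T.-1] would demand a state in row [T]. *)
  have := hstep tr; rewrite ceval_imp => /(_ htr); case: tr {htr} => -[q a] [[q' b] d].
  rewrite /trans_step !cevalE => -[_ [_ [/(_ q') + _]]]; rewrite !cevalE eqxx.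
  by case=> _ /(_ isT) []; lia.
elim=> [|t IH] ht.
  exists (initial M w); split=> //; apply/first_row_describes => p hp.
  by have := H _ _ T0 hp; rewrite /tableau !ceval_and ceval_imp => -[_ [/(_ erefl)]].
have ht' := ltnW ht; have [c [hc hd]] := IH ht'.
have := H _ 0 ht' T0; rewrite /tableau !ceval_and ceval_or !ceval_forall.
rewrite ceval_exists => -[_ [_ [[hhalt|[tr htr]] [hacc _]]]].
  case: nacc; exists t, c; split=> //.
  have := hacc (cstate c); rewrite !cevalE; apply; split=> //.
  by case: (hd _ T0) => ->.
have {}hstep p : p < T -> eval (trans_step tr) t p.
  move=> hp; have := H _ _ ht' hp; rewrite /tableau !ceval_and.
  rewrite !ceval_forall => -[_ [_ [_ [_ /(_ tr)]]]].
  by rewrite ceval_imp; apply; rewrite -const.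
case: tr hstep {htr} => -[q a] [[q' b] d] hstep.
have hv : valid (q, a, (q', b, d)).
  by have := hstep 0 T0; rewrite /trans_step !cevalE => -[].
have hh i : chead c i <= t := steps_head i hc.
have [hq ha hn] := proj1 (trans_step_describes ht hh hv hd) hstep.
exists (apply_trans q' b d c); split=> //; apply: steps_rcons hc _.
exists q', b, d; split=> //; rewrite hq.
have -> : (fun i => ctape c i (chead c i)) = a by apply/funext.
by move: hv => /asboolP.
Qed.

End Correct.
Definition trans_of (c c' : config M) (tr : trans) : Prop :=
  let: (q, a, (q', b, d)) := tr in
  [/\ valid tr, cstate c = q, forall i, ctape c i (chead c i) = a i &
      c' = apply_trans q' b d c].

Lemma step_trans_of c c' : step c c' -> exists tr, trans_of c c' tr.
Proof.
move=> [q' [b [d [hd ->]]]].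
have E (X : Type) (h : tape -> X) : [ffun i => h i] = h :> (tape -> X).
  by apply/funext => i; rewrite ffunE.
exists (cstate c, [ffun i => ctape c i (chead c i)],
  (q', [ffun i => b i], [ffun i => d i])); split=> //.
- by rewrite /valid !E; apply/asboolP.
- by move=> i; rewrite ffunE.
by rewrite /apply_trans !E.
Qed.

Definition trajectory_cells (m : nat) (f : nat -> config M)
    (trf : nat -> trans) (x : kind) (t p : nat) : Prop :=
  match x with
  | inl (inl q) => q = cstate (f t)
  | inl (inr None) => m <= t
  | inl (inr (Some tr)) => t < m /\ tr = trf t
  | inr (inl i) => p = chead (f t) i
  | inr (inr (i, s)) => s = ctape (f t) i p
  end.

Lemma tableau_complete (w : seq bool) (T : nat) :
  accepts M w -> (forall m c, steps m (initial M w) c -> m < T) ->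
  exists Q, forall t p, t < T -> p < T -> ceval w T Q tableau t p.
Proof.
move=> [m [c [hc hacc]]] hT; have hmT := hT _ _ hc.
have [f [f0 fm hf]] := steps_trajectory hc.
have [trf htr] : {trf : nat -> trans &
    forall t, t < m -> trans_of (f t) (f t.+1) (trf t)}.
  apply: (@choice _ _ (fun t tr => t < m -> trans_of (f t) (f t.+1) tr)) => t.
  have [htm|htm] := ltnP t m; first by have [tr] := step_trans_of (hf t htm); exists tr.
  by exists (start M, [ffun=> blank M], (start M, [ffun=> blank M], [ffun=> Stay])).
(* The computation is frozen in its accepting configuration after step [m], so that the remaining
   rows are filled too. *)
pose g t := f (minn t m).
have hg t : t <= m -> g t = f t by rewrite /g => /minn_idPl ->.
exists (trajectory_cells m g trf) => t p ht hp.
set Q := trajectory_cells _ _ _.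
have hd t' : describes w T Q t' (g t') by [].
rewrite /tableau !ceval_and; split.
  rewrite ceval_forall => x; rewrite /same_in_row ceval_imp ceval_rgt => -[hp1 _].
  by rewrite ceval_iff ceval_rgt; case: x => [q|[tr|]] /=; split=> [[]|].
split.
  rewrite ceval_imp => t0; rewrite {1}(_ : t = 0) //.
  apply: (proj2 (first_row_describes w T Q)) => //.
  by rewrite -f0 -(hg 0).
have [htm|htm] := ltnP t m; last first.
  split; first by rewrite ceval_or; left.
  split; rewrite ceval_forall.
    move=> q; rewrite ceval_imp ceval_bool ceval_and => -[_ ->] /=.
    by rewrite /g (minn_idPr htm) fm.
  by move=> tr; rewrite ceval_imp => -[/=]; lia.
split; first by rewrite ceval_or ceval_exists; right; exists (trf t).
split; rewrite ceval_forall.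
  by move=> q; rewrite ceval_imp ceval_and => -[/=]; lia.
move=> tr; rewrite ceval_imp => -[_ ->].
have := htr t htm; rewrite -(hg t (ltnW htm)) -(hg t.+1 htm).
case: (trf t) => -[q a] [[q' b] d] [hv hq ha hn].
have ht1 : t.+1 < T by lia.
have hh i : chead (g t) i <= t.
  have := trajectory_steps hf (ltnW htm).
  by rewrite f0 -(hg t (ltnW htm)); apply: steps_head.
apply: (proj2 (trans_step_describes ht1 hh hv (hd t))) => //.
by split=> //; rewrite -hn.
Qed.

End Tableau.

Lemma updateE (U : Type) (e : nat -> U) x a y :
  update e x a y = if y == x then a else e y.
Proof. by []. Qed.

(** * Coordinates of the cells *)

Section Numerals.
Variables (U : Type) (N : nat) (rk : U -> nat).

Fixpoint numeral (e : nat -> U) (vs : seq nat) : nat :=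
  if vs is v :: vs' then rk (e v) + N * numeral e vs' else 0.

Lemma eq_numeral e e' vs : {in vs, e =1 e'} -> numeral e vs = numeral e' vs.
Proof.
elim: vs => [//|v vs IH] h /=.
by rewrite h ?mem_head // IH // => x hx; apply: h; rewrite inE hx orbT.
Qed.

Hypothesis rk_lt : forall u, rk u < N.

Lemma numeral_lt e vs : numeral e vs < N ^ size vs.
Proof.
elim: vs => [//|v vs IH] /=; rewrite expnS.
have := rk_lt (e v); move: (N ^ _) IH => X; nia.
Qed.

Lemma numeral_inj e e' vs : injective rk ->
  numeral e vs = numeral e' vs -> {in vs, e =1 e'}.
Proof.
move=> rk_inj; elim: vs => [//|v vs IH] /= h.
have hN : 0 < N by have := rk_lt (e v); lia.
have hv : rk (e v) = rk (e' v).
  by have := congr1 (modn^~ N) h; rewrite !(addnC (rk _)) !(mulnC N) !modnMDl !modn_small.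
move=> x; rewrite inE => /predU1P[->|]; first exact: rk_inj.
by apply: IH; apply/eqP; rewrite -(eqn_pmul2l hN); apply/eqP; lia.
Qed.

Lemma numeral_surj e vs m : (forall r, r < N -> exists u, rk u = r) ->
  uniq vs -> m < N ^ size vs ->
  exists e', (forall v, v \notin vs -> e' v = e v) /\ numeral e' vs = m.
Proof.
move=> rk_surj; elim: vs m => [|v vs IH] m /=.
  by move=> _; rewrite expn0 ltnS leqn0 => /eqP ->; exists e.
move=> /andP[hv hu]; rewrite expnS => hm.
have hN : 0 < N by nia.
have [|e' [he' hm']] := IH (m %/ N) hu; first by rewrite ltn_divLR // mulnC.
have [u hur] := rk_surj (m %% N) (ltn_pmod m hN).
exists (update e' v u); split.
  move=> x; rewrite inE updateE negb_or => /andP[/negPf -> hx]; exact: he'.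
rewrite updateE eqxx hur (@eq_numeral _ e') ?hm'; first by have := divn_eq m N; lia.
by move=> x hx; rewrite updateE; case: eqP => // xv; rewrite -xv hx in hv.
Qed.

End Numerals.

Section Coordinates.
Variables (k c : nat) (U : Type) (N : nat) (rk : U -> nat).
Variables (s : nat) (pz : nat -> nat -> U).

Local Notation xs := (iota 0 k).
Local Notation ys := (iota k k).
Local Notation z := (2 * k).

Definition extent := N ^ k * (s * c.+1).

(* [(j, l)] and the values of the variables below [2 k + 1] encode the time [t]
   and the position [p], whose high digits are [(a, j)] and [(b, l)]. *)
Definition encodes (e : nat -> U) (j l t p : nat) : Prop :=
  exists a b, [/\ a < s /\ j <= c, b < s /\ l <= c, e z = pz a b,
    t = numeral N rk e xs + N ^ k * (a + s * j) &
    p = numeral N rk e ys + N ^ k * (b + s * l)].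

Hypothesis rk_inj : injective rk.
Hypothesis rk_lt : forall u, rk u < N.
Hypothesis rk_surj : forall r, r < N -> exists u, rk u = r.
Hypothesis pz_inj : forall a b a' b', a < s -> b < s -> a' < s -> b' < s ->
  pz a b = pz a' b' -> a = a' /\ b = b'.

Lemma xs_lt e : numeral N rk e xs < N ^ k.
Proof. by have := numeral_lt rk_lt e xs; rewrite size_iota. Qed.

Lemma ys_lt e : numeral N rk e ys < N ^ k.
Proof. by have := numeral_lt rk_lt e ys; rewrite size_iota. Qed.

Lemma encodes_lt e j l t p : encodes e j l t p -> t < extent /\ p < extent.
Proof.
move=> [a [b [[ha hj] [hb hl] _ -> ->]]]; rewrite /extent.
have := xs_lt e; have := ys_lt e; move: (N ^ k) => X h1 h2.
have : a + s * j < s * c.+1 by nia.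
have : b + s * l < s * c.+1 by nia.
by move: (s * c.+1) (a + _) (b + _) => Y A B; nia.
Qed.

Lemma radix_inj B m m' q q' : m < B -> m' < B ->
  m + B * q = m' + B * q' -> m = m' /\ q = q'.
Proof.
move=> hm hm' h; have hB : 0 < B by lia.
have e : m = m'.
  have := congr1 (modn^~ B) h.
  by rewrite !(addnC _ (B * _)) !(mulnC B) !modnMDl !modn_small.
by split=> //; apply/eqP; rewrite -(eqn_pmul2l hB); apply/eqP; lia.
Qed.

(** Needed to read a tableau off a model: a cell has one tuple of coordinates, so the truth of
    [at_cell] depends on the cell alone. *)
Lemma encodes_inj e e' j l j' l' t p :
  encodes e j l t p -> encodes e' j' l' t p ->
  [/\ j = j', l = l' & forall v, v < (2 * k).+1 -> e v = e' v].
Proof.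
move=> [a [b [[ha hj] [hb hl] hz ht hp]]] [a' [b' [[ha' hj'] [hb' hl'] hz' ht' hp']]].
rewrite ht in ht'; rewrite hp in hp'.
have [hx /radix_inj [//|//|ea ej]] := radix_inj (xs_lt e) (xs_lt e') ht'.
have [hy /radix_inj [//|//|eb el]] := radix_inj (ys_lt e) (ys_lt e') hp'.
split=> // v; rewrite ltnS leq_eqVlt => /predU1P[->|hv].
  by rewrite hz hz' ea eb.
have [vk|vk] := ltnP v k.
  by apply: (numeral_inj rk_lt rk_inj hx); rewrite mem_iota; lia.
by apply: (numeral_inj rk_lt rk_inj hy); rewrite mem_iota; lia.
Qed.

(** The converse, needed to build a model: a tuple of coordinates names one cell, so a relation on
    cells can be read as a relation on tuples. *)
Lemma encodes_fun e e' j l t p t' p' :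
  (forall v, v < (2 * k).+1 -> e v = e' v) ->
  encodes e j l t p -> encodes e' j l t' p' -> t = t' /\ p = p'.
Proof.
move=> he [a [b [[ha hj] [hb hl] hz -> ->]]] [a' [b' [[ha' _] [hb' _] hz' -> ->]]].
rewrite he // hz' in hz.
have [<- <-] := pz_inj ha' hb' ha hb hz.
have E vs : {subset vs <= iota 0 (2 * k)} -> numeral N rk e vs = numeral N rk e' vs.
  move=> hvs; apply: eq_numeral => v /hvs; rewrite mem_iota => hv; apply: he; lia.
by rewrite !E // => v; rewrite !mem_iota; lia.
Qed.

Lemma encodes_surj t p : t < extent -> p < extent ->
  exists e j l, encodes e j l t p.
Proof.
rewrite /extent => ht hp.
have hX : 0 < N ^ k by move: ht; case: (N ^ k).
have hs : 0 < s by move: ht; case: (s) => //; rewrite mul0n muln0.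
pose a := t %/ N ^ k %% s; pose b := p %/ N ^ k %% s.
(* Starting from the constant assignment [pz a b] gives variable [z] its value, since [z] belongs to
   neither block of digits. *)
have [e1 [h1 n1]] : exists e', (forall v, v \notin ys -> e' v = pz a b) /\
    numeral N rk e' ys = p %% N ^ k.
  by apply: numeral_surj; rewrite ?iota_uniq ?size_iota ?ltn_pmod.
have [e2 [h2 n2]] : exists e', (forall v, v \notin xs -> e' v = e1 v) /\
    numeral N rk e' xs = t %% N ^ k.
  by apply: numeral_surj; rewrite ?iota_uniq ?size_iota ?ltn_pmod.
exists e2, (t %/ N ^ k %/ s), (p %/ N ^ k %/ s), a, b.
have D q : q < N ^ k * (s * c.+1) -> q %/ N ^ k %/ s <= c.
  by move=> hq; rewrite -ltnS ltn_divLR // ltn_divLR // mulnC [c.+1 * s]mulnC.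
have E q : q = q %% N ^ k + N ^ k * (q %/ N ^ k %% s + s * (q %/ N ^ k %/ s)).
  have := divn_eq q (N ^ k); have := divn_eq (q %/ N ^ k) s.
  by move=> {1}-> {1}->; lia.
split=> //.
- by rewrite ltn_pmod // D.
- by rewrite ltn_pmod // D.
- by rewrite h2 ?h1 ?mem_iota //; lia.
- by rewrite n2.
rewrite (@eq_numeral _ _ _ _ e1) ?n1 // => v; rewrite mem_iota => hv.
by apply: h2; rewrite mem_iota; lia.
Qed.

End Coordinates.

(** * Formulas with few variables *)

Section Derived.
Variable V : vocabulary.

Definition FTrue : formula V := Eq V 0 0.
Definition FImp (f g : formula V) := Or (Not f) g.
Definition FIff (f g : formula V) := And (FImp f g) (FImp g f).
Definition conjunction (fs : seq (formula V)) := foldr (@And V) FTrue fs.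
Definition closure (b : nat) (f : formula V) := foldr (@Forall V) f (iota 0 b).
Definition bounded (b : nat) (f : formula V) := all (gtn b) (vars f).

Variables (S : structure V) (e : nat -> universe S).

Lemma sat_not f : sat e (Not f) = ~ sat e f. Proof. by []. Qed.
Lemma sat_and f g : sat e (And f g) = (sat e f /\ sat e g). Proof. by []. Qed.
Lemma sat_or f g : sat e (Or f g) = (sat e f \/ sat e g). Proof. by []. Qed.
Lemma sat_eq x y : sat e (Eq V x y) = (e x = e y). Proof. by []. Qed.
Lemma sat_exists x f : sat e (Exists x f) = exists a, sat (update e x a) f.
Proof. by []. Qed.
Lemma sat_true : sat e FTrue = True. Proof. exact: iff_eq. Qed.
Lemma sat_imp f g : sat e (FImp f g) = (sat e f -> sat e g).
Proof.
by apply: iff_eq; rewrite /FImp sat_or sat_not; have [|] := EM (sat e f); tauto.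
Qed.
Lemma sat_iff f g : sat e (FIff f g) = (sat e f <-> sat e g).
Proof. by rewrite /FIff sat_and !sat_imp. Qed.
Lemma sat_conjunction fs :
  sat e (conjunction fs) <-> forall i, i < size fs -> sat e (nth FTrue fs i).
Proof.
elim: fs => [|f fs IH]; first by split.
split=> [[hf /IH h] [|i]|h] //; first exact: h.
by split; [apply: (h 0)|apply/IH => i; apply: (h i.+1)].
Qed.

Lemma sat_conjunction_map (X : eqType) (f : X -> formula V) (xs : seq X) :
  sat e (conjunction [seq f x | x <- xs]) <-> {in xs, forall x, sat e (f x)}.
Proof.
elim: xs => [|x xs IH]; first by split.
split=> [[hx /IH h] y|h]; first by rewrite inE => /predU1P[->|/h].
split; first by apply: h; rewrite inE eqxx.
by apply/IH => y hy; apply: h; rewrite inE hy orbT.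
Qed.

Lemma bounded_and b f g : bounded b (And f g) = bounded b f && bounded b g.
Proof. exact: all_cat. Qed.
Lemma bounded_or b f g : bounded b (Or f g) = bounded b f && bounded b g.
Proof. exact: all_cat. Qed.
Lemma bounded_not b f : bounded b (Not f) = bounded b f. Proof. by []. Qed.
Lemma bounded_exists b x f : bounded b (Exists x f) = (x < b) && bounded b f.
Proof. by []. Qed.
Lemma bounded_eq b x y : bounded b (Eq V x y) = (x < b) && (y < b).
Proof. by rewrite /bounded /= andbT. Qed.
Lemma bounded_imp b f g : bounded b (FImp f g) = bounded b f && bounded b g.
Proof. exact: bounded_or. Qed.
Lemma bounded_iff b f g : bounded b (FIff f g) = bounded b f && bounded b g.
Proof. by rewrite bounded_and !bounded_imp; do 2!case: bounded. Qed.
Lemma bounded_conjunction b fs :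
  0 < b -> all (bounded b) fs -> bounded b (conjunction fs).
Proof.
move=> hb; elim: fs => [|f fs IH]; first by move=> _; rewrite bounded_eq hb.
by move=> /andP[hf /IH hfs]; rewrite /= bounded_and hf.
Qed.

End Derived.

(** [model] already ranges over all assignments, so closing only removes the free variables. *)
Lemma model_closure (V : vocabulary) (S : structure V) b (f : formula V) :
  model S (closure b f) <-> model S f.
Proof.
rewrite /closure; elim: (iota 0 b) => [//|x vs IH] /=.
rewrite -IH; split=> h e; last by move=> a; apply: h.
have := h e (e x); congr (sat _ _); apply/funext => y.
by rewrite updateE; case: eqP => [->|].
Qed.

Lemma free_vars_vars (V : vocabulary) (f : formula V) :
  {subset free_vars f <= vars f}.
Proof.
elim: f => [x y|s us|f IH|f IHf g IHg|f IHf g IHg|x f IH|x f IH] //= v.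
- by rewrite !mem_cat => /orP[/IHf|/IHg] ->; rewrite ?orbT.
- by rewrite !mem_cat => /orP[/IHf|/IHg] ->; rewrite ?orbT.
- by rewrite mem_filter inE => /andP[_ /IH ->]; rewrite orbT.
- by rewrite mem_filter inE => /andP[_ /IH ->]; rewrite orbT.
Qed.

Lemma sentence_closure (V : vocabulary) b (f : formula V) :
  bounded b f -> sentence (closure b f).
Proof.
move=> /allP hb; rewrite /sentence /closure.
have E vs : free_vars (foldr (@Forall V) f vs) = [seq v <- free_vars f | v \notin vs].
  elim: vs => [|x vs IH] /=; first by rewrite filter_predT.
  by rewrite IH -filter_predI; apply: eq_filter => v /=; rewrite inE negb_or.
rewrite E; apply/eqP; rewrite -[_ == _]negbK -has_filter; apply/hasPn => v.
by move=> /free_vars_vars /hb /= hv; rewrite negbK mem_iota.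
Qed.

Lemma num_vars_closure (V : vocabulary) b (f : formula V) :
  bounded b f -> num_vars (closure b f) <= b.
Proof.
move=> /allP hb; rewrite /num_vars -[leqRHS](size_iota 0).
apply: uniq_leq_size; first exact: undup_uniq.
move=> v; rewrite mem_undup /closure => hv; rewrite mem_iota /= add0n.
suff: v \in iota 0 b ++ vars f.
  by rewrite mem_cat mem_iota => /orP[//|/hb].
elim: (iota 0 b) hv => [//|x vs IH] /=; rewrite !inE.
by move=> /predU1P[->|/IH ->]; rewrite ?eqxx ?orbT.
Qed.

(** * Auxiliary relation symbols and binary prefixes *)

Inductive base := LtS | DigitS | PairS | DoubleS | PrefixS.
Definition base_code (b : base) : 'I_5 :=
  inord (match b with
         | LtS => 0 | DigitS => 1 | PairS => 2 | DoubleS => 3 | PrefixS => 4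
         end).
Definition base_decode (i : 'I_5) : base :=
  nth LtS [:: LtS; DigitS; PairS; DoubleS; PrefixS] i.
Lemma base_codeK : cancel base_code base_decode.
Proof. by case; rewrite /base_decode inordK. Qed.
HB.instance Definition _ := Finite.copy base (can_type base_codeK).

Lemma divn_trunc_log N : 0 < N -> N %/ 2 ^ trunc_log 2 N = 1.
Proof.
move=> hN; have /andP[h1 h2] := trunc_log_bounds (isT : 1 < 2) hN.
apply/eqP; rewrite eqn_leq leq_divRL ?expn_gt0 // mul1n h1 andbT.
by rewrite -ltnS ltn_divLR ?expn_gt0 // -expnS.
Qed.

Lemma trunc_log_lt N : 0 < N -> trunc_log 2 N < N.
Proof.
move=> hN; have /andP[h1 _] := trunc_log_bounds (isT : 1 < 2) hN.
exact: leq_trans (ltn_expl _ (isT : 1 < 2)) h1.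
Qed.

(* A chain of numbers below [N], each obtained from the previous one by
   appending a bit to the binary notation of its successor, must consist of the
   predecessors of the prefixes of [N] if it starts at [0] and reaches [N.-1]. *)
Lemma prefix_chain (N : nat) (pre : nat -> nat -> Prop) : 0 < N ->
  (forall q r, pre q r -> r < N) ->
  (forall r, pre 0 r <-> r = 0) ->
  (forall q r, pre q.+1 r ->
     exists r', pre q r' /\ (r = 2 * r' + 1 \/ r = 2 * r' + 2)) ->
  (exists q, pre q N.-1) ->
  (forall q r r', pre q r -> pre q r' -> r = r') ->
  forall q r, pre q r <->
    q <= trunc_log 2 N /\ r.+1 = N %/ 2 ^ (trunc_log 2 N - q).
Proof.
move=> hN hlt h0 hS [P hP] hf.
(* Going back from [N.-1] halves at each step: [r = 2 * r' + 1] and [r = 2 * r' + 2] both give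
   [r'.+1 = r.+1 %/ 2]. *)
have down d : d <= P -> exists2 r, pre (P - d) r & r.+1 = N %/ 2 ^ d.
  elim: d => [|d IH] hd; first by exists N.-1; rewrite ?subn0 // expn0 divn1; lia.
  have [r] := IH (ltnW hd); have -> : P - d = (P - d.+1).+1 by lia.
  move=> /hS [r' [hr' hrr]] hr; exists r' => //.
  by rewrite expnSr divnMA -hr; case: hrr => ->; lia.
(* The chain starts at 0, so [N %/ 2 ^ P = 1]. *)
have eP : P = trunc_log 2 N.
  have [r] := down P (leqnn P); rewrite subnn => /h0 -> h1; symmetry.
  apply: trunc_log_eq => //; apply/andP; split.
    by rewrite -[2 ^ P]mul1n -leq_divRL ?expn_gt0 // -h1.
  by rewrite expnS -ltn_divLR ?expn_gt0 // -h1.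
(* An entry following [N.-1] would be at least [2 * N.-1 + 1 >= N]. *)
have up i r : ~ pre (P + i.+1) r.
  elim: i r => [|i IH] r; rewrite addnS => h.
    have [r'] := hS _ _ h; rewrite addn0 => -[/hf /(_ hP) -> hr].
    by have := hlt _ _ h; lia.
  by have [r' [/IH]] := hS _ _ h.
move=> q r; rewrite -eP; split=> [h|[hq hr]].
  have hq : q <= P.
    rewrite leqNgt; apply/negP => hq; apply: (up (q - P.+1) r).
    by rewrite (_ : P + _ = q) //; lia.
  have [r'] := down _ (leq_subr q P); rewrite subKn // => h' hr'.
  by rewrite (hf _ _ _ h h').
have [r'] := down _ (leq_subr q P); rewrite subKn // -hr => h' [] hr'.
by rewrite -hr'.
Qed.

Lemma radix_eq0 B m q : 0 < B -> m + B * q = 0 <-> m = 0 /\ q = 0.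
Proof. by move=> hB; split=> [|[-> ->]]; [nia|rewrite muln0]. Qed.

Lemma radix_small B m q n : m + B * q < n -> n <= B -> q = 0.
Proof.
move=> h1 h2; have hB : 0 < B by lia.
apply/eqP; rewrite -leqn0 -ltnS -(ltn_pmul2l hB) muln1.
exact: leq_ltn_trans (leq_addl m _) (leq_trans h1 h2).
Qed.

Lemma nth_binary N p : p <= trunc_log 2 N ->
  nth false (binary N) p = odd (N %/ 2 ^ (trunc_log 2 N - p)).
Proof.
move=> hp; rewrite /binary (nth_map 0) ?size_rev ?size_iota //.
by rewrite nth_rev ?size_iota // nth_iota ?subSS //; lia.
Qed.

Lemma size_binary N : size (binary N) = (trunc_log 2 N).+1.
Proof. by rewrite size_map size_rev size_iota. Qed.

(** * The spectrum sentence *)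

Section Sentence.
Variables (k c : nat) (K : finType).
Hypothesis hk : 2 <= k.

Definition voc : vocabulary :=
  @Vocabulary (base + K * ('I_c.+1 * 'I_c.+1))%type (fun=> (2 * k).+1)
    (fun=> erefl).

Local Notation "f /&\ g" := (And f g) (at level 60, right associativity).
Local Notation z := (2 * k).
Local Notation w := (2 * k).+1.

Definition atom (r : rel_symbol voc) (g : nat -> nat) : formula voc :=
  @Rel voc r [tuple g i | i < (2 * k).+1].
(* Every symbol has arity [2 k + 1]; the symbols below only look at their first
   arguments. *)
Definition lt u v := atom (inl LtS) (nth v [:: u]).
Definition digit u := atom (inl DigitS) (fun=> u).
Definition pair v a b := atom (inl PairS) (nth b [:: v; a]).
Definition double u v := atom (inl DoubleS) (nth v [:: u]).
Definition prefix u v := atom (inl PrefixS) (nth v [:: u]).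
Definition at_cell x j l := atom (inr (x, (inord j, inord l))) id.

(* The first argument of each of the following is a scratch variable. *)
Definition zero v u : formula voc := Not (Exists v (lt v u)).
Definition max v u : formula voc := Not (Exists v (lt u v)).
Definition succ v u u' : formula voc :=
  lt u u' /&\ Not (Exists v (lt u v /&\ lt v u')).

(** In order: a strict linear order; digits that form a nonempty initial segment; a pairing that is
    total on digits, functional and injective; doubling, by recursion along the order; prefixes, as
    in [prefix_chain]. No variable exceeds 5, which fits in [2 k + 2] variables because [k >= 2]. *)
Definition frame_axioms : seq (formula voc) :=
  [:: Not (lt 0 0);
      FImp (lt 0 1 /&\ lt 1 2) (lt 0 2);
      Or (lt 0 1) (Or (Eq voc 0 1) (lt 1 0));
      Exists 0 (digit 0);
      FImp (digit 1 /&\ lt 0 1) (digit 0);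
      FImp (pair 0 1 2) (digit 1 /&\ digit 2);
      FImp (digit 1 /&\ digit 2) (Exists 0 (pair 0 1 2));
      FImp (pair 0 1 2 /&\ pair 3 1 2) (Eq voc 0 3);
      FImp (pair 0 1 2 /&\ pair 0 3 4) (Eq voc 1 3 /&\ Eq voc 2 4);
      FImp (zero 5 0) (FIff (double 0 1) (zero 5 1));
      FImp (succ 5 0 1) (FIff (double 1 2)
        (Exists 3 (Exists 4 (double 0 3 /&\ succ 5 3 4 /&\ succ 5 4 2))));
      FImp (zero 5 0) (FIff (prefix 0 1) (zero 5 1));
      FImp (succ 5 0 1 /&\ prefix 1 2)
        (Exists 3 (Exists 4 (prefix 0 3 /&\ double 3 4 /&\
          Or (succ 5 4 2) (Exists 5 (succ 0 4 5 /&\ succ 0 5 2)))));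
      Exists 0 (Exists 1 (prefix 0 1 /&\ max 5 1));
      FImp (prefix 0 1 /&\ prefix 0 2) (Eq voc 1 2)].

(** The new value of [v] is found in [w] while [v] still has its old value, and is then copied.
    After that [w] may be bound again, so a single extra variable serves any nesting depth. *)
Definition subst v r f : formula voc :=
  Exists w (r /&\ Exists v (Eq voc v w /&\ f)).

(* The pair [(a, b)] is coded by the variable [z]; [sw] exchanges the roles of [a]
   and [b], to pass from the time to the position. *)
Definition high (sw : bool) v a b := if sw then pair v b a else pair v a b.
(** The digit variables 0 to 3 are rebound as scratch; as [2 * k >= 4], they are distinct from [z]
    and [w]. In [subst] the formula [f] lies outside these quantifiers and sees the original
    digits. *)
Definition high_succ sw : formula voc := Exists 0 (Exists 1 (Exists 2
  (high sw z 0 1 /&\ succ 3 0 2 /&\ high sw w 2 1))).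
Definition high_wrap sw : formula voc := Exists 0 (Exists 1 (Exists 2
  (high sw z 0 1 /&\ Not (Exists 3 (lt 0 3 /&\ digit 3)) /&\ zero 3 2 /&\
   high sw w 2 1))).
Definition high_zero sw : formula voc :=
  Exists 0 (Exists 1 (high sw z 0 1 /&\ zero 2 0)).
Definition zeros vs : formula voc := conjunction [seq zero z v | v <- vs].
(** [w] is the predecessor of a prefix, so the last bit of that prefix is 1 exactly when the rank of
    [w] is even. The position is the digit [k], the lowest one. *)
Definition bit (b : bool) : formula voc :=
  let even := Exists z (double z w) in
  Exists w (prefix k w /&\ if b then even else Not even).

(* [incr sw vs f g] holds when [f] does after the number with the digits [vs]
   (low digit first) and then the high digit is incremented, or when [g] does
   if all these digits overflow to [0]. *)
Fixpoint incr sw vs (f g : formula voc) : formula voc :=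
  if vs is v :: vs' then
    Or (subst v (succ z v w) f)
       (max z v /&\ subst v (zero z w) (incr sw vs' f g))
  else Or (subst z (high_succ sw) f) (subst z (high_wrap sw) g).

Definition FFalse := Not (FTrue voc).

(** [j] and [l] are indices of symbols, not values of variables, so a carry out of the high digit
    selects another formula: the second alternative of [incr] is the translation at the next index,
    or falsity when the edge of the square is reached. A position inside the input word is below
    [N], whence the test for [Input] that all digits but the lowest vanish. *)
Fixpoint translate (d : cell K) (j l : nat) : formula voc :=
  match d with
  | Atom x => at_cell x j l
  | Row0 => if j == 0 then high_zero false /&\ zeros (iota 0 k) else FFalse
  | Col0 => if l == 0 then high_zero true /&\ zeros (iota k k) else FFalse
  | Input b => if l == 0 then
      high_zero true /&\ zeros (iota k.+1 k.-1) /&\ bit b else FFalse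
  | Next d' => incr false (iota 0 k) (translate d' j l)
      (if j < c then translate d' j.+1 l else FFalse)
  | Rgt d' => incr true (iota k k) (translate d' j l)
      (if l < c then translate d' j l.+1 else FFalse)
  | CNot d' => Not (translate d' j l)
  | CAnd d1 d2 => translate d1 j l /&\ translate d2 j l
  end.

(** The guard leaves out the values of [z] that code no pair of digits and so belong to no cell. *)
Definition spectrum_sentence (d : cell K) : formula voc :=
  closure w.+1 (conjunction frame_axioms /&\
    conjunction [seq FImp (Exists 0 (Exists 1 (pair z 0 1)))
                          (translate d jl.1 jl.2)
                | jl <- [seq (j, l) | j <- iota 0 c.+1, l <- iota 0 c.+1]]).

(** * Meaning of the sentence in an arbitrary structure *)

Section Interpretation.
Variable S : structure voc.
Local Notation U := (universe S).

Definition interp_nth (r : rel_symbol voc) (g : nat -> U) : Prop :=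
  interp (s := r) [tuple g i | i < (2 * k).+1].
Definition Lt u v := interp_nth (inl LtS) (nth v [:: u]).
Definition Digit u := interp_nth (inl DigitS) (fun=> u).
Definition Pair v a b := interp_nth (inl PairS) (nth b [:: v; a]).
Definition Double u v := interp_nth (inl DoubleS) (nth v [:: u]).
Definition Prefix u v := interp_nth (inl PrefixS) (nth v [:: u]).

Lemma sat_atom e r g : sat e (atom r g) = interp_nth r (e \o g).
Proof.
rewrite /=; congr (interp _); apply: eq_from_tnth => i.
by rewrite tnth_map !tnth_mktuple.
Qed.

Lemma sat_lt e u v : sat e (lt u v) = Lt (e u) (e v).
Proof. by rewrite sat_atom; congr interp_nth; apply/funext => -[|[|i]]. Qed.

Lemma sat_digit e u : sat e (digit u) = Digit (e u).
Proof. exact: sat_atom. Qed.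

Lemma sat_double e u v : sat e (double u v) = Double (e u) (e v).
Proof. by rewrite sat_atom; congr interp_nth; apply/funext => -[|[|i]]. Qed.

Lemma sat_prefix e u v : sat e (prefix u v) = Prefix (e u) (e v).
Proof. by rewrite sat_atom; congr interp_nth; apply/funext => -[|[|i]]. Qed.

Lemma sat_pair e v a b : sat e (pair v a b) = Pair (e v) (e a) (e b).
Proof. by rewrite sat_atom; congr interp_nth; apply/funext => -[|[|[|i]]]. Qed.

Record ranking (rk : U -> nat) : Prop := Ranking {
  rank_inj : injective rk;
  rank_lt : forall u, rk u < #|U|;
  rank_Lt : forall u v, Lt u v <-> rk u < rk v }.

Section Ranking.
Variable rk : U -> nat.
Hypothesis hrk : ranking rk.

Lemma rank_surj r : r < #|U| -> exists u, rk u = r.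
Proof.
move=> hr; pose f u := Ordinal (rank_lt hrk u).
have fI : injective f by move=> u v /(congr1 val) /(rank_inj hrk).
have [g _ gf] := inj_card_bij fI (eq_leq (card_ord _)).
by exists (g (Ordinal hr)); have /(congr1 val) := gf (Ordinal hr).
Qed.

Lemma sat_zero e v u : v != u -> sat e (zero v u) <-> rk (e u) = 0.
Proof.
rewrite /zero sat_not sat_exists => /negPf hv; split=> [h|h [a]].
  apply/eqP; rewrite -leqn0 leqNgt; apply/negP => hu; apply: h.
  have [a ha] : exists a, rk a = 0 by apply: rank_surj; have := rank_lt hrk (e u); lia.
  by exists a; rewrite sat_lt !updateE eqxx eq_sym hv (rank_Lt hrk) ha.
by rewrite sat_lt !updateE eqxx eq_sym hv (rank_Lt hrk) h.
Qed.

Lemma sat_max e v u : v != u -> sat e (max v u) <-> (rk (e u)).+1 = #|U|.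
Proof.
rewrite /max sat_not sat_exists => /negPf hv; split=> [h|h [a]].
  have hu := rank_lt hrk (e u).
  apply/eqP; rewrite eqn_leq hu /= leqNgt; apply/negP => /rank_surj [a ha].
  by apply: h; exists a; rewrite sat_lt !updateE eqxx eq_sym hv (rank_Lt hrk) ha.
rewrite sat_lt !updateE eqxx eq_sym hv (rank_Lt hrk).
by have := rank_lt hrk a; lia.
Qed.

Lemma sat_succ e v u u' : v != u -> v != u' ->
  sat e (succ v u u') <-> rk (e u') = (rk (e u)).+1.
Proof.
move=> /negPf hv /negPf hv'; rewrite /succ sat_and sat_not sat_exists sat_lt.
rewrite (rank_Lt hrk); split=> [[h1 h2]|h].
  apply/eqP; rewrite eqn_leq h1 andbT leqNgt; apply/negP => h3.
  have [a ha] : exists a, rk a = (rk (e u)).+1.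
    by apply: rank_surj; have := rank_lt hrk (e u'); lia.
  apply: h2; exists a; rewrite sat_and !sat_lt !updateE eqxx eq_sym hv eq_sym hv'.
  by rewrite !(rank_Lt hrk) ha.
split=> [|[a]]; first by rewrite h.
rewrite sat_and !sat_lt !updateE eqxx eq_sym hv eq_sym hv' !(rank_Lt hrk); lia.
Qed.

End Ranking.

(** The rank of an element is the number of elements below it. *)
Lemma ranking_exists :
  (forall u, ~ Lt u u) -> (forall u v x, Lt u v -> Lt v x -> Lt u x) ->
  (forall u v, [\/ Lt u v, u = v | Lt v u]) -> exists rk, ranking rk.
Proof.
move=> irr trans tot.
pose D u := [set v : U | `[< Lt v u >]]%SET.
have inD x u : x \in D u <-> Lt x u by rewrite finset.in_set; split=> /asboolP.
have mono u v : Lt u v -> #|D u| < #|D v|.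
  move=> huv; apply: proper_card; apply/properP; split.
    by apply/fintype.subsetP => x /inD hx; apply/inD; apply: trans hx huv.
  by exists u; [apply/inD|apply/negP => /inD /irr].
exists (fun u => #|D u|); split.
- by move=> u v h; case: (tot u v) => // /mono; rewrite h ltnn.
- move=> u; rewrite -cardsT; apply: proper_card; apply/properP; split.
    by apply/fintype.subsetP => x; rewrite finset.inE.
  by exists u; [rewrite finset.in_setT|apply/negP => /inD /irr].
move=> u v; split=> [/mono //|h].
by case: (tot u v) => // [e|/mono]; [rewrite e ltnn in h|lia].
Qed.

Local Notation N := #|U|.
Local Notation len := (trunc_log 2 N).

(** The arithmetic content of [frame_axioms], shared by the two inclusions. [pz] is meaningful only
    on arguments below [s]. *)
Record frame (rk : U -> nat) (s : nat) (pz : nat -> nat -> U) : Prop := Frame {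
  frame_rank : ranking rk;
  frame_gt0 : 0 < s;
  frame_le : s <= N;
  frame_digit : forall u, Digit u <-> rk u < s;
  frame_pair : forall v a b, Pair v a b <->
    [/\ rk a < s, rk b < s & v = pz (rk a) (rk b)];
  frame_inj : forall a b a' b', a < s -> b < s -> a' < s -> b' < s ->
    pz a b = pz a' b' -> a = a' /\ b = b';
  frame_double : forall u v, Double u v <-> rk v = 2 * rk u;
  frame_prefix : forall u v, Prefix u v <->
    rk u <= len /\ (rk v).+1 = N %/ 2 ^ (len - rk u) }.

Lemma frame_of_axioms : (forall e, sat (S := S) e (conjunction frame_axioms)) -> 0 < N ->
  exists rk s pz, frame rk s pz.
Proof.
move=> hax hN; have /card_gt0P [u0 _] := hN.
(* The list [us] gives the values of the variables 0, 1, and so on. *)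
have ax us i : i < 15 -> sat (nth u0 us) (nth (FTrue voc) frame_axioms i).
  by move=> hi; have /sat_conjunction := hax (nth u0 us); apply.
have [rk hrk] : exists rk, ranking rk.
  apply: ranking_exists => [u huu|u v x|u v].
  - by have := ax [:: u] 0 isT; rewrite sat_not sat_lt; apply.
  - have := ax [:: u; v; x] 1 isT; rewrite sat_imp sat_and !sat_lt.
    by move=> h ? ?; apply: h.
  have := ax [:: u; v] 2 isT; rewrite !sat_or sat_eq !sat_lt.
  by move=> [?|[?|?]]; [apply: Or31|apply: Or32|apply: Or33].
have [d0 hd0] : exists d, Digit d.
  by have := ax [::] 3 isT; rewrite sat_exists => -[d]; rewrite sat_digit; exists d.
(* A nonempty initial segment is determined by its largest element. *)
have [m /asboolP dm hm] := @arg_maxnP _ d0 (fun u => `[< Digit u >]) rk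
  (introT (asboolP _) hd0).
pose s := (rk m).+1.
have hdigit u : Digit u <-> rk u < s.
  split=> [/asboolP /hm //|]; rewrite ltnS leq_eqVlt => /predU1P[|hu].
    by move=> /(rank_inj hrk) ->.
  have := ax [:: u; m] 4 isT; rewrite sat_imp sat_and !sat_digit sat_lt.
  by apply; split=> //; apply/(rank_Lt hrk).
have hp5 v a b : Pair v a b -> rk a < s /\ rk b < s.
  have := ax [:: v; a; b] 5 isT; rewrite sat_imp sat_and !sat_digit sat_pair.
  by move=> h /h [/hdigit ? /hdigit].
have hp6 a b : rk a < s -> rk b < s -> exists v, Pair v a b.
  have := ax [:: a; a; b] 6 isT; rewrite sat_imp sat_and !sat_digit sat_exists.
  by move=> h /hdigit ha /hdigit hb; have [v] := h (conj ha hb); rewrite sat_pair; exists v.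
have hp7 v v' a b : Pair v a b -> Pair v' a b -> v = v'.
  have := ax [:: v; a; b; v'] 7 isT; rewrite sat_imp sat_and !sat_pair sat_eq.
  by move=> h ? ?; apply: h.
have hp8 v a b a' b' : Pair v a b -> Pair v a' b' -> a = a' /\ b = b'.
  have := ax [:: v; a; b; a'; b'] 8 isT; rewrite sat_imp !sat_and !sat_pair !sat_eq.
  by move=> h ? ?; apply: h.
have hdouble u v : Double u v <-> rk v = 2 * rk u.
  have hz : forall u v, rk u = 0 -> Double u v <-> rk v = 0.
    move=> {}u {}v.
    have := ax [:: u; v] 9 isT; rewrite sat_imp sat_iff sat_double.
    by rewrite !(sat_zero hrk) // => h /h.
  have hs : forall u u' v, rk u' = (rk u).+1 -> Double u' v <->
      exists x y, [/\ Double u x, rk y = (rk x).+1 & rk v = (rk y).+1].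
    move=> {}u u' {}v; have := ax [:: u; u'; v] 10 isT.
    rewrite sat_imp sat_iff sat_double (sat_succ hrk) //.
    move=> h /h ->; rewrite sat_exists; split=> [[x]|[x [y [h1 h2 h3]]]].
      rewrite sat_exists => -[y]; rewrite 2!sat_and sat_double !(sat_succ hrk) //.
      by move=> [? []]; exists x, y.
    exists x; rewrite sat_exists; exists y.
    by rewrite 2!sat_and sat_double !(sat_succ hrk).
  (* The recursion equations determine doubling: if [2 * n + 2] is a rank, so are [2 * n] and
     [2 * n + 1]. *)
  move e: (rk u) => n; elim: n u v e => [|n IH] u v e; first by rewrite hz.
  have [u' hu'] : exists u', rk u' = n by apply: (rank_surj hrk); have := rank_lt hrk u; lia.
  rewrite (hs u'); last by rewrite hu'.
  split=> [[x [y [/(IH _ _ hu') hx hy ->]]]|hv]; first lia.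
  have hvN := rank_lt hrk v.
  have [x hx] : exists x, rk x = 2 * n by apply: (rank_surj hrk); lia.
  have [y hy] : exists y, rk y = (2 * n).+1 by apply: (rank_surj hrk); lia.
  by exists x, y; rewrite hx hy; split; [apply/(IH _ _ hu')|..]; lia.
(* Choice turns the pairing of elements into a function of their ranks, with value [u0] outside its
   domain. *)
have [pz hpz] : {pz : nat * nat -> U & forall ab, forall u v,
    rk u = ab.1 -> rk v = ab.2 -> ab.1 < s -> ab.2 < s -> Pair (pz ab) u v}.
  apply: (@choice _ _ (fun ab x => forall u v,
    rk u = ab.1 -> rk v = ab.2 -> ab.1 < s -> ab.2 < s -> Pair x u v)) => -[a b] /=.
  have [[u [v [hu hv ha hb]]]|no] :=
    EM (exists u v, [/\ rk u = a, rk v = b, a < s & b < s]).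
    have [x hx] : exists x, Pair x u v by apply: hp6; rewrite ?hu ?hv.
    exists x => u' v' hu' hv' _ _.
    by rewrite (rank_inj hrk (etrans hu' (esym hu))) (rank_inj hrk (etrans hv' (esym hv))).
  by exists u0 => u v hu hv ha hb; case: no; exists u, v.
have sN : s <= N by apply: (rank_lt hrk).
exists rk, s, (fun a b => pz (a, b)); split=> //.
- move=> v a b; split=> [h|[ha hb ->]]; last exact: hpz.
  have [ha hb] := hp5 _ _ _ h; split=> //; apply: hp7 h _; exact: hpz.
- move=> a b a' b' ha hb ha' hb' e.
  have [u hu] := rank_surj hrk (leq_trans ha sN).
  have [v hv] := rank_surj hrk (leq_trans hb sN).
  have [u' hu'] := rank_surj hrk (leq_trans ha' sN).
  have [v' hv'] := rank_surj hrk (leq_trans hb' sN).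
  have h := hpz (a, b) u v hu hv ha hb.
  have h' := hpz (a', b') u' v' hu' hv' ha' hb'.
  rewrite -e in h'; have [eu ev] := hp8 _ _ _ _ _ h h'.
  by rewrite -hu -hv -hu' -hv' eu ev.
have hf u v v' : Prefix u v -> Prefix u v' -> v = v'.
  have := ax [:: u; v; v'] 14 isT; rewrite sat_imp sat_and !sat_prefix sat_eq.
  by move=> h ? ?; apply: h.
pose pre q r := exists u v, [/\ rk u = q, rk v = r & Prefix u v].
have hpre u v : Prefix u v <-> pre (rk u) (rk v).
  split=> [h|[u' [v' [/(rank_inj hrk) -> /(rank_inj hrk) ->]]] //]; by exists u, v.
move=> u v; rewrite hpre; apply: prefix_chain => //.
- by move=> q r [_ [x [_ <- _]]]; apply: rank_lt.
- have hz x y : rk x = 0 -> Prefix x y <-> rk y = 0.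
    have := ax [:: x; y] 11 isT; rewrite sat_imp sat_iff sat_prefix.
    by rewrite !(sat_zero hrk) // => h /h.
  move=> r; split=> [[x [y [hx <- /hz]]]|->]; first exact.
  by have [x hx] := rank_surj hrk hN; exists x, x; split=> //; apply/hz.
- move=> q r [x' [y [hx' <- hxy]]]; have hxN := rank_lt hrk x'.
  have [x hx] : exists x, rk x = q by apply: (rank_surj hrk); lia.
  have := ax [:: x; x'; y] 12 isT; rewrite sat_imp sat_and sat_prefix (sat_succ hrk) //.
  rewrite [nth _ _ _]/= [in nth _ _ 0]/= hx hx' => /(_ (conj erefl hxy)).
  rewrite sat_exists => -[m']; rewrite sat_exists => -[d].
  rewrite 2!sat_and sat_or sat_prefix sat_double => -[hm' [/hdouble hd h]].
  exists (rk m'); split; first by exists x, m'.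
  case: h; first by rewrite (sat_succ hrk) // => /= ->; left; rewrite addn1; congr _.+1.
  rewrite sat_exists => -[d']; rewrite sat_and !(sat_succ hrk) // => /= -[-> ->] /=.
  by move: hd; rewrite /update /= => ->; right; rewrite addn2.
- have := ax [::] 13 isT; rewrite sat_exists => -[x]; rewrite sat_exists => -[y].
  rewrite sat_and sat_prefix (sat_max hrk) // => -[hxy /= e].
  by move: e; rewrite /update /= => e; exists (rk x), x, y; split=> //; lia.
move=> q r r' [x [y [hx <- hxy]]] [x' [y' [hx' <- hxy']]].
have exx : x = x' by apply: (rank_inj hrk); rewrite hx hx'.
by rewrite exx in hxy; rewrite (hf _ _ _ hxy hxy').
Qed.

Lemma axioms_of_frame rk s pz : frame rk s pz -> 0 < N ->
  forall e, sat (S := S) e (conjunction frame_axioms).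
Proof.
move=> [hrk s0 sN hdigit hpair hinj hdouble hprefix] hN e.
have lenN := trunc_log_lt hN.
have surj := rank_surj hrk.
apply/sat_conjunction => -[|[|[|[|[|[|[|[|[|[|[|[|[|[|[|i]]]]]]]]]]]]]]] // _;
  rewrite [nth _ _ _]/=.
- by rewrite sat_not sat_lt (rank_Lt hrk) ltnn.
- by rewrite sat_imp sat_and !sat_lt !(rank_Lt hrk) => -[]; apply: ltn_trans.
- rewrite !sat_or sat_eq !sat_lt !(rank_Lt hrk).
  by case: (ltngtP (rk (e 0)) (rk (e 1))) => [||/(rank_inj hrk) ->];
    [left|right; right|right; left].
- have [u hu] := surj 0 hN.
  by rewrite sat_exists; exists u; rewrite sat_digit hdigit hu.
- rewrite sat_imp sat_and !sat_digit sat_lt !hdigit (rank_Lt hrk) => -[h1 h2].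
  exact: ltn_trans h2 h1.
- by rewrite sat_imp sat_and !sat_digit sat_pair !hdigit hpair => -[].
- rewrite sat_imp sat_and !sat_digit !hdigit sat_exists => -[h1 h2].
  by exists (pz (rk (e 1)) (rk (e 2))); rewrite sat_pair hpair.
- by rewrite sat_imp sat_and !sat_pair !hpair sat_eq => -[[_ _ ->] [_ _ ->]].
- rewrite sat_imp !sat_and !sat_pair !hpair !sat_eq => -[[h1 h2 ->] [h3 h4]].
  by move=> /(hinj _ _ _ _ h1 h2 h3 h4) [/(rank_inj hrk) -> /(rank_inj hrk) ->].
- rewrite sat_imp sat_iff sat_double !(sat_zero hrk) // hdouble => ->; lia.
- rewrite sat_imp sat_iff sat_double (sat_succ hrk) // hdouble => ->.
  rewrite sat_exists; split=> [hv|[x]].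
    have hv2 := rank_lt hrk (e 2).
    have [x hx] : exists x, rk x = 2 * rk (e 0) by apply: surj; lia.
    have [y hy] : exists y, rk y = (2 * rk (e 0)).+1 by apply: surj; lia.
    exists x; rewrite sat_exists; exists y.
    rewrite 2!sat_and sat_double hdouble !(sat_succ hrk) // /update /=; lia.
  rewrite sat_exists => -[y].
  rewrite 2!sat_and sat_double hdouble !(sat_succ hrk) // /update /=; lia.
- rewrite sat_imp sat_iff sat_prefix !(sat_zero hrk) // hprefix => ->.
  by rewrite subn0 divn_trunc_log //; split=> [[_ [->]]|->].
- rewrite sat_imp sat_and sat_prefix (sat_succ hrk) // hprefix => -[-> [hle hr]].
  have hd : N %/ 2 ^ (len - rk (e 0)) = (rk (e 2)).+1 %/ 2.
    by rewrite hr -divnMA -expnSr; congr (_ %/ 2 ^ _); lia.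
  (* The shorter prefix is at least 1, so its predecessor is a rank that represents it. *)
  have hpos : 0 < N %/ 2 ^ (len - rk (e 0)).
    rewrite divn_gt0 ?expn_gt0 //; apply: leq_trans (_ : 2 ^ len <= _).
      by rewrite leq_pexp2l //; lia.
    by have /andP[] := trunc_log_bounds (isT : 1 < 2) hN.
  have h2 := rank_lt hrk (e 2).
  have [m hm] : exists m, rk m = ((rk (e 2)).+1 %/ 2).-1 by apply: surj; lia.
  have [d hdm] : exists d, rk d = 2 * rk m by apply: surj; lia.
  rewrite sat_exists; exists m; rewrite sat_exists; exists d.
  rewrite 2!sat_and sat_prefix sat_double hprefix hdouble; split.
    by rewrite /update /= hm -hd (prednK hpos); split=> //; apply: ltnW.
  split; first by rewrite /update.
  rewrite sat_or sat_exists.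
  have [par|par] : rk (e 2) = 2 * rk m + 1 \/ rk (e 2) = 2 * rk m + 2 by lia.
    by left; rewrite (sat_succ hrk) // /update /=; lia.
  have [d' hd'] : exists d', rk d' = 2 * rk m + 1 by apply: surj; lia.
  by right; exists d'; rewrite sat_and !(sat_succ hrk) // /update /=; lia.
- have [u hu] := surj _ lenN; have [v hv] : exists v, rk v = N.-1 by apply: surj; lia.
  rewrite sat_exists; exists u; rewrite sat_exists; exists v.
  rewrite sat_and sat_prefix hprefix (sat_max hrk) // /update /= hu hv.
  by rewrite subnn expn0 divn1 prednK.
rewrite sat_imp sat_and !sat_prefix !hprefix sat_eq => -[[_ h1] [_ h2]].
by apply: (rank_inj hrk); lia.
Qed.

Section Frame.
Variables (rk : U -> nat) (s : nat) (pz : nat -> nat -> U).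
Hypothesis hF : frame rk s pz.
Let hrk := frame_rank hF.
Local Notation num := (numeral N rk).

(** The first argument is the high digit to be incremented, whether it belongs to the time or to the
    position. *)
Definition code (sw : bool) a b := if sw then pz b a else pz a b.

Lemma code_inj sw a b a' b' : a < s -> b < s -> a' < s -> b' < s ->
  code sw a b = code sw a' b' -> a = a' /\ b = b'.
Proof.
case: sw => /= ha hb ha' hb' h; last exact: (frame_inj hF).
by have [-> ->] := frame_inj hF hb ha hb' ha' h.
Qed.

Lemma sat_high e sw v a b : sat e (high sw v a b) <->
  [/\ rk (e a) < s, rk (e b) < s & e v = code sw (rk (e a)) (rk (e b))].
Proof.
rewrite /high /code; case: sw; rewrite sat_pair (frame_pair hF) //.
by split=> -[].
Qed.

Lemma varE : ((2 * k == 0) = false) * ((2 * k == 1) = false) *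
  ((2 * k == 2) = false) * ((2 * k == 3) = false) *
  (((2 * k).+1 == 0) = false) * (((2 * k).+1 == 1) = false) *
  (((2 * k).+1 == 2) = false) * (((2 * k).+1 == 3) = false).
Proof. by do ![split]; lia. Qed.

Lemma rank_lt_s r : r < s -> exists u, rk u = r.
Proof. by move=> hr; apply: (rank_surj hrk (leq_trans hr (frame_le hF))). Qed.

Lemma sat_high_succ e sw a b : a < s -> b < s -> e z = code sw a b ->
  sat e (high_succ sw) <-> a.+1 < s /\ e w = code sw a.+1 b.
Proof.
move=> ha hb hz; rewrite /high_succ sat_exists; split=> [[u0]|[ha1 hw]].
  rewrite sat_exists => -[u1]; rewrite sat_exists => -[u2].
  rewrite 2!sat_and !sat_high (sat_succ hrk) // !updateE !varE /= hz.
  move=> [[h0 h1 /(code_inj ha hb h0 h1) [ea eb]]] [e2 [h2 _ ->]].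
  by rewrite eb ea -e2.
have [u0 hu0] := rank_lt_s ha; have [u1 hu1] := rank_lt_s hb.
have [u2 hu2] := rank_lt_s ha1.
exists u0; rewrite sat_exists; exists u1; rewrite sat_exists; exists u2.
by rewrite 2!sat_and !sat_high (sat_succ hrk) // !updateE !varE /= hz hw hu0 hu1 hu2.
Qed.

Lemma sat_high_wrap e sw a b : a < s -> b < s -> e z = code sw a b ->
  sat e (high_wrap sw) <-> a.+1 = s /\ e w = code sw 0 b.
Proof.
move=> ha hb hz; rewrite /high_wrap sat_exists.
(* This bounds the rank of variable 0 from below; the upper bound comes with [high]. *)
have E (e' : nat -> U) : sat e' (Not (Exists 3 (lt 0 3 /&\ digit 3))) <->
    s <= (rk (e' 0)).+1.
  rewrite sat_not sat_exists leqNgt; split=> [h|/negP h [u]].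
    apply/negP => h1; have [u hu] := rank_lt_s h1; apply: h; exists u.
    by rewrite sat_and sat_lt sat_digit (rank_Lt hrk) (frame_digit hF) !updateE /= hu.
  rewrite sat_and sat_lt sat_digit (rank_Lt hrk) (frame_digit hF) !updateE /=; lia.
split=> [[u0]|[ha1 hw]].
  rewrite sat_exists => -[u1]; rewrite sat_exists => -[u2].
  rewrite 2!sat_and sat_and !sat_high E (sat_zero hrk) // !updateE !varE /= hz.
  move=> [[h0 h1 /(code_inj ha hb h0 h1) [ea eb]]] [e2 [h2 [_ _ ->]]].
  by rewrite eb h2; split=> //; lia.
have [u0 hu0] := rank_lt_s ha; have [u1 hu1] := rank_lt_s hb.
have [u2 hu2] := rank_lt_s (frame_gt0 hF).
exists u0; rewrite sat_exists; exists u1; rewrite sat_exists; exists u2.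
rewrite 2!sat_and sat_and !sat_high E (sat_zero hrk) // !updateE !varE /= hz hw.
by rewrite hu0 hu1 hu2 ha1 (frame_gt0 hF).
Qed.

Lemma sat_high_zero e sw a b : a < s -> b < s -> e z = code sw a b ->
  sat e (high_zero sw) <-> a = 0.
Proof.
move=> ha hb hz; rewrite /high_zero sat_exists; split=> [[u0]|a0].
  rewrite sat_exists => -[u1].
  rewrite sat_and sat_high (sat_zero hrk) // !updateE !varE /= hz.
  by move=> [[h0 h1 /(code_inj ha hb h0 h1) [-> _]]].
have [u0 hu0] := rank_lt_s ha; have [u1 hu1] := rank_lt_s hb.
exists u0; rewrite sat_exists; exists u1.
by rewrite sat_and sat_high (sat_zero hrk) // !updateE !varE /= hz hu0 hu1.
Qed.

Lemma sat_zeros e vs : all (gtn z) vs -> sat e (zeros vs) <-> num e vs = 0.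
Proof.
have hN : 0 < N := leq_trans (frame_gt0 hF) (frame_le hF).
elim: vs => [|v vs IH]; first by move=> _; split.
move=> /andP[hv /IH {}IH]; rewrite /= in hv.
rewrite (_ : zeros (v :: vs) = (zero z v /&\ zeros vs)) // sat_and IH.
rewrite (sat_zero hrk); last lia.
rewrite /=; move: (rk _) (num _ _) => A B.
split=> [[-> ->]|/eqP]; first by rewrite muln0.
rewrite addn_eq0 muln_eq0 => /andP[/eqP -> /orP[|/eqP -> //]].
by rewrite eqn0Ngt hN.
Qed.

Lemma sat_subst e v r f : v != w -> sat (S := S) e (subst v r f) <->
  exists u, sat (S := S) (update e w u) r /\
    sat (S := S) (update (update e w u) v u) f.
Proof.
move=> /negPf hv; rewrite /subst sat_exists; split=> -[u].
  rewrite sat_and sat_exists => -[hr [u']].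
  rewrite sat_and sat_eq !updateE !eqxx eq_sym hv => -[-> hf]; by exists u.
move=> [hr hf]; exists u; rewrite sat_and sat_exists; split=> //; exists u.
by rewrite sat_and sat_eq !updateE !eqxx eq_sym hv.
Qed.

(** At each digit exactly one alternative of [incr] applies, according to whether that digit
    overflows, so [f] and [g] may share the meaning [P]. The digits and the high digit are read as
    one number. Agreement with [e] leaves out [w], which is scratch, and [z], which holds the high
    digit. *)
Lemma sat_incr sw vs e f g a b (P : Prop) :
  uniq vs -> all (gtn z) vs -> a < s -> b < s -> e z = code sw a b ->
  (forall e' a', (forall v, v \notin [:: z, w & vs] -> e' v = e v) ->
     a' < s -> e' z = code sw a' b ->
     num e' vs + N ^ size vs * a' = (num e vs + N ^ size vs * a).+1 ->
     sat (S := S) e' f <-> P) ->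
  (forall e', (forall v, v \notin [:: z, w & vs] -> e' v = e v) ->
     e' z = code sw 0 b -> num e' vs = 0 ->
     (num e vs + N ^ size vs * a).+1 = N ^ size vs * s ->
     sat (S := S) e' g <-> P) ->
  sat (S := S) e (incr sw vs f g) <-> P.
Proof.
move=> + + ha hb; elim: vs e => [|v vs IH] e.
  move=> _ _ hz hf hg; rewrite [incr _ _ _ _]/= sat_or !sat_subst; try lia.
  have E u v : v \notin [:: z; w] -> update (update e w u) z u v = e v.
    by rewrite !inE negb_or !updateE => /andP[/negPf -> /negPf ->].
  have hz' u : update e w u z = code sw a b by rewrite updateE; case: eqP => //; lia.
  have [ha1|ha1] := ltnP a.+1 s.
    have hf' : sat (update (update e w (code sw a.+1 b)) z (code sw a.+1 b)) f <-> P.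
      by apply: (hf _ a.+1) => //; first [exact: E|rewrite updateE eqxx //|move=> /=; lia].
    split=> [[[u []]|[u []]]|hP].
    - by rewrite (sat_high_succ ha hb (hz' _)) updateE eqxx => -[_ ->] /hf'.
    - by rewrite (sat_high_wrap ha hb (hz' _)) => -[]; lia.
    left; exists (code sw a.+1 b); rewrite (sat_high_succ ha hb (hz' _)) updateE eqxx.
    by split=> //; apply/hf'.
  have hg' : sat (update (update e w (code sw 0 b)) z (code sw 0 b)) g <-> P.
    by apply: hg => //; first [exact: E|rewrite updateE eqxx //|move=> /=; lia].
  split=> [[[u []]|[u []]]|hP].
  - by rewrite (sat_high_succ ha hb (hz' _)) => -[]; lia.
  - by rewrite (sat_high_wrap ha hb (hz' _)) updateE eqxx => -[_ ->] /hg'.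
  right; exists (code sw 0 b); rewrite (sat_high_wrap ha hb (hz' _)) updateE eqxx.
  by split; [split=> //; lia|apply/hg'].
move=> /andP[hv hu] /andP[hvz hall] hz hf hg; rewrite /= in hvz hf hg.
have vz : v != z by lia.
have vw : v != w by lia.
rewrite (_ : incr sw (v :: vs) f g = Or (subst v (succ z v w) f)
  (max z v /&\ subst v (zero z w) (incr sw vs f g))) // sat_or sat_and.
rewrite !sat_subst //.
have E u x : x \notin [:: z, w, v & vs] -> update (update e w u) v u x = e x.
  rewrite !inE !negb_or !updateE => /and4P[_ /negPf -> /negPf -> _] //.
have hz' u : update (update e w u) v u z = code sw a b.
  by rewrite !updateE; do 2![case: eqP => [|_]; first lia].
have Evs u : num (update (update e w u) v u) vs = num e vs.
  apply: eq_numeral => x hx; rewrite !updateE; case: eqP => [xv|_].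
    by rewrite -xv hx in hv.
  by case: eqP => // xw; move/allP: hall => /(_ _ hx) /=; lia.
have hmax : sat e (max z v) <-> (rk (e v)).+1 = N by apply: (sat_max hrk); lia.
have hsucc u : sat (update e w u) (succ z v w) <-> rk u = (rk (e v)).+1.
  rewrite (sat_succ hrk) ?updateE ?eqxx ?(negPf vw) //; lia.
have hzero u : sat (update e w u) (zero z w) <-> rk u = 0.
  by rewrite (sat_zero hrk) ?updateE ?eqxx //; lia.
have hlt := rank_lt hrk (e v).
have [h1|h1] := ltnP (rk (e v)).+1 N.
  have [u hu1] := rank_surj hrk h1.
  have hf' : sat (update (update e w u) v u) f <-> P.
    apply: (hf _ a) => //; first exact: E.
    by rewrite Evs updateE eqxx hu1 !addSn.
  split=> [[[u' [/hsucc]]|[/hmax]]|hP]; last 1 first.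
  - by left; exists u; rewrite hsucc hf'.
  - by rewrite -hu1 => /(rank_inj hrk) -> /hf'.
  lia.
(* Here [v] overflows: it is reset to 0 and one is carried into the remaining digits. *)
have eN : (rk (e v)).+1 = N by lia.
have [u hu0] : exists u, rk u = 0 by apply: (rank_surj hrk); lia.
have hI : sat (update (update e w u) v u) (incr sw vs f g) <-> P.
  apply: IH => //.
    move=> e' a' he' ha' hz'' hnum; have e'v : e' v = u.
      by rewrite he' ?updateE ?eqxx // !inE !negb_or vz vw hv.
    apply: (hf _ a') => //.
      move=> x hx; rewrite he' ?E //; move: hx; rewrite !inE !negb_or.
      by move=> /and4P[-> -> _ ->].
    rewrite e'v hu0; move: hnum; rewrite Evs expnS -eN; move: (_ ^ _) => X; nia.
  move=> e' he' hz'' h0 hnum; have e'v : e' v = u.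
    by rewrite he' ?updateE ?eqxx // !inE !negb_or vz vw hv.
  apply: hg => //.
  - move=> x hx; rewrite he' ?E //; move: hx; rewrite !inE !negb_or.
    by move=> /and4P[-> -> _ ->].
  - by rewrite e'v hu0 h0; lia.
  move: hnum; rewrite Evs expnS -eN; move: (_ ^ _) => X; nia.
split=> [[[u' [/hsucc]]|[_ [u' [/hzero]]]]|hP]; last 1 first.
- by right; split; [apply/hmax|exists u; split; [apply/hzero|apply/hI]].
- by have := rank_lt hrk u'; lia.
by move=> h0; rewrite (rank_inj hrk (etrans h0 (esym hu0))); apply: (proj1 hI).
Qed.

Local Notation T := (extent k c N s).
Local Notation pt := (encodes k c N rk s pz).

Lemma sat_bit e b : sat e (bit b) <->
  rk (e k) < size (binary N) /\ nth false (binary N) (rk (e k)) = b.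
Proof.
have hN : 0 < N := leq_trans (frame_gt0 hF) (frame_le hF).
have kw : (k == w) = false by lia.
have wz : (w == z) = false by lia.
rewrite size_binary ltnS /bit sat_exists.
have E u : sat (update e w u) (if b then Exists z (double z w)
    else Not (Exists z (double z w))) <-> odd (rk u).+1 = b.
  have D : sat (update e w u) (Exists z (double z w)) <-> odd (rk u).+1.
    rewrite sat_exists; split=> [[h]|ho].
      rewrite sat_double (frame_double hF) !updateE !eqxx wz => ->.
      by rewrite /= oddM.
    have [h hh] : exists h, rk h = (rk u)./2.
      by apply: (rank_surj hrk); have := rank_lt hrk u; lia.
    exists h; rewrite sat_double (frame_double hF) !updateE !eqxx wz hh; lia.
  case: b; first by rewrite D; split=> [->|].
  by rewrite sat_not D; split=> [/negP/negbTE|->].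
split=> [[u]|[hle hb]].
  rewrite sat_and E sat_prefix (frame_prefix hF) !updateE eqxx kw.
  by move=> [[hle hu] <-]; split=> //; rewrite nth_binary // -hu.
have hpos : 0 < N %/ 2 ^ (trunc_log 2 N - rk (e k)).
  rewrite divn_gt0 ?expn_gt0 //; apply: leq_trans (_ : 2 ^ trunc_log 2 N <= _).
    by rewrite leq_pexp2l //; lia.
  by have /andP[] := trunc_log_bounds (isT : 1 < 2) hN.
have [u hu] : exists u, rk u = (N %/ 2 ^ (trunc_log 2 N - rk (e k))).-1.
  apply: (rank_surj hrk); rewrite prednK //; exact: leq_div.
exists u; rewrite sat_and E sat_prefix (frame_prefix hF) !updateE eqxx kw.
by rewrite hu prednK // -nth_binary.
Qed.

Variable Q : K -> nat -> nat -> Prop.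
Hypothesis Q_cell : forall x e j l t p, pt e j l t p ->
  sat e (at_cell x j l) <-> Q x t p.

Lemma sat_translate d e j l t p : pt e j l t p ->
  sat e (translate d j l) <-> ceval (binary N) T Q d t p.
Proof.
have hN : 0 < N := leq_trans (frame_gt0 hF) (frame_le hF).
have hX : 0 < N ^ k by rewrite expn_gt0 hN.
have s0 := frame_gt0 hF.
have false_sat (e' : nat -> U) : ~ sat e' FFalse by rewrite sat_not sat_true; apply.
elim: d e j l t p => [x|||b|d IH|d IH|d IH|d IHd d' IHd'] e j l t p hp.
- exact: Q_cell.
- have [a [b [[ha hj] [hb hl] hz -> _]]] := hp.
  rewrite ceval_row0 /=; case: eqP => [->|j0]; last first.
    by split=> [/false_sat //|]; rewrite !radix_eq0 // => -[_ []].
  rewrite sat_and (@sat_high_zero _ _ a b) // sat_zeros; last first.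
    by apply/allP => x; rewrite mem_iota /=; lia.
  by rewrite !radix_eq0 //; split=> [[]|[? []]].
- have [a [b [[ha hj] [hb hl] hz _ ->]]] := hp.
  rewrite ceval_col0 /=; case: eqP => [->|l0]; last first.
    by split=> [/false_sat //|]; rewrite !radix_eq0 // => -[_ []].
  rewrite sat_and (@sat_high_zero _ _ b a) // sat_zeros; last first.
    by apply/allP => x; rewrite mem_iota /=; lia.
  by rewrite !radix_eq0 //; split=> [[]|[? []]].
- have [a [b' [[ha hj] [hb hl] hz _ ->]]] := hp.
  (* A position inside the word is below [N], so only its lowest digit can be nonzero. *)
  have leN : size (binary N) <= N by rewrite size_binary trunc_log_lt.
  have NX : N <= N ^ k by rewrite -{1}(expn1 N) leq_pexp2l //; lia.
  have ek : iota k k = k :: iota k.+1 k.-1 by case: (k) hk.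
  rewrite /ceval ek [translate _ _ _]/=; case: eqP => [->|l0]; last first.
    split=> [/false_sat //|[h1 _]]; case: l0.
    by have /eqP := radix_small h1 (leq_trans leN NX); rewrite addn_eq0 muln_eq0; lia.
  rewrite 2!sat_and sat_bit (@sat_high_zero _ _ b' a) // sat_zeros; last first.
    by apply/allP => x; rewrite mem_iota /=; lia.
  rewrite muln0 addn0 [numeral _ _ _ (_ :: _)]/=.
  split=> [[-> [-> [h1 h2]]]|[h1 h2]]; first by rewrite !muln0 !addn0.
  have [b0 n0] : b' = 0 /\ num e (iota k.+1 k.-1) = 0.
    have b0 := radix_small h1 (leq_trans leN NX); split=> //.
    by move: h1; rewrite b0 muln0 addn0 => /radix_small; apply.
  by move: h1 h2; rewrite b0 n0 !muln0 !addn0.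
- have [a [b [[ha hj] [hb hl] hz et ep]]] := hp.
  rewrite ceval_next [translate _ _ _]/=.
  apply: (@sat_incr false _ _ _ _ a b); rewrite ?iota_uniq ?size_iota //.
  + by apply/allP => x; rewrite mem_iota /=; lia.
  + move=> e' a' he' ha' hz' hnum.
    have hp' : pt e' j l t.+1 p.
      exists a', b; split=> //; first by rewrite et; lia.
      rewrite ep; congr (_ + _); apply: eq_numeral => v hv; symmetry; apply: he'.
      by move: hv; rewrite !inE !mem_iota; lia.
    rewrite (IH _ _ _ _ _ hp'); split=> [h|[]] //; split=> //.
    by have [] := encodes_lt (rank_lt hrk) hp'.
  move=> e' he' hz' h0 hnum; case: ltnP => hjc.
    have hp' : pt e' j.+1 l t.+1 p.
      exists 0, b; split=> //; first by rewrite et h0; lia.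
      rewrite ep; congr (_ + _); apply: eq_numeral => v hv; symmetry; apply: he'.
      by move: hv; rewrite !inE !mem_iota; lia.
    rewrite (IH _ _ _ _ _ hp'); split=> [h|[]] //; split=> //.
    by have [] := encodes_lt (rank_lt hrk) hp'.
  (* Overflow at the last index means [t.+1 = T], where [Next] fails as well. *)
  have ej : j = c by lia.
  by split=> [/false_sat //|[]]; rewrite et ej /extent; lia.
- have [a [b [[ha hj] [hb hl] hz et ep]]] := hp.
  rewrite ceval_rgt [translate _ _ _]/=.
  apply: (@sat_incr true _ _ _ _ b a); rewrite ?iota_uniq ?size_iota //.
  + by apply/allP => x; rewrite mem_iota /=; lia.
  + move=> e' b' he' hb' hz' hnum.
    have hp' : pt e' j l t p.+1.
      exists a, b'; split=> //; last by rewrite ep; lia.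
      rewrite et; congr (_ + _); apply: eq_numeral => v hv; symmetry; apply: he'.
      by move: hv; rewrite !inE !mem_iota; lia.
    rewrite (IH _ _ _ _ _ hp'); split=> [h|[]] //; split=> //.
    by have [] := encodes_lt (rank_lt hrk) hp'.
  move=> e' he' hz' h0 hnum; case: ltnP => hlc.
    have hp' : pt e' j l.+1 t p.+1.
      exists a, 0; split=> //; last by rewrite ep h0; lia.
      rewrite et; congr (_ + _); apply: eq_numeral => v hv; symmetry; apply: he'.
      by move: hv; rewrite !inE !mem_iota; lia.
    rewrite (IH _ _ _ _ _ hp'); split=> [h|[]] //; split=> //.
    by have [] := encodes_lt (rank_lt hrk) hp'.
  have el : l = c by lia.
  by split=> [/false_sat //|[]]; rewrite ep el /extent; lia.
- by rewrite ceval_not [translate _ _ _]/= sat_not (IH _ _ _ _ _ hp).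
by rewrite ceval_and [translate _ _ _]/= sat_and (IHd _ _ _ _ _ hp) (IHd' _ _ _ _ _ hp).
Qed.

End Frame.
Lemma sat_at_cell e x j l :
  sat e (at_cell x j l) = interp_nth (inr (x, (inord j, inord l))) e.
Proof. exact: sat_atom. Qed.

Lemma sat_domain rk s pz e : frame rk s pz ->
  sat e (Exists 0 (Exists 1 (pair z 0 1))) <->
  exists a b, [/\ a < s, b < s & e z = pz a b].
Proof.
move=> hF; rewrite sat_exists; split=> [[u]|[a [b [ha hb hz]]]].
  rewrite sat_exists => -[v]; rewrite sat_pair (frame_pair hF) !updateE !varE /=.
  by move=> [h1 h2 ->]; exists (rk u), (rk v).
have [u hu] := rank_lt_s hF ha; have [v hv] := rank_lt_s hF hb.
exists u; rewrite sat_exists; exists v.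
by rewrite sat_pair (frame_pair hF) !updateE !varE /= hu hv.
Qed.

Lemma model_tableau d : model S (spectrum_sentence d) -> 0 < N ->
  exists s Q, 0 < s /\ forall t p, t < extent k c N s -> p < extent k c N s ->
    ceval (binary N) (extent k c N s) Q d t p.
Proof.
move=> /model_closure hm hN.
have [|rk [s [pz hF]]] := frame_of_axioms _ hN; first by move=> e; have [] := hm e.
have hrk := frame_rank hF.
(* By [encodes_inj] it does not matter which coordinates of the cell are taken. *)
pose Q x t p := exists e j l, encodes k c N rk s pz e j l t p /\
  sat (S := S) e (at_cell x j l).
exists s, Q; split=> [|t p ht hp]; first exact: (frame_gt0 hF).
have [e [j [l he]]] := encodes_surj pz (rank_surj hrk) ht hp.
have Q_cell x e' j' l' t' p' : encodes k c N rk s pz e' j' l' t' p' ->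
    sat e' (at_cell x j' l') <-> Q x t' p'.
  move=> he'; split=> [h|[e'' [j'' [l'' [he'' h]]]]]; first by exists e', j', l'.
  have [-> -> hee] := encodes_inj (rank_inj hrk) (rank_lt hrk) he' he''.
  move: h; rewrite !sat_at_cell /interp_nth; congr (interp _).
  by apply: eq_from_tnth => i; rewrite !tnth_mktuple hee.
apply/(sat_translate hF Q_cell d he).
have := hm e; rewrite sat_and => -[_ /sat_conjunction_map /(_ (j, l))].
have [a [b [[ha hj] [hb hl] hz _ _]]] := he.
have hjl : (j, l) \in [seq (j, l) | j <- iota 0 c.+1, l <- iota 0 c.+1].
  by apply/allpairsP; exists (j, l); rewrite !mem_iota; split=> //; lia.
move=> /(_ hjl); rewrite sat_imp; apply.
by apply/(sat_domain _ hF); exists a, b.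
Qed.

Lemma tableau_model d rk s pz Q : frame rk s pz -> 0 < N ->
  (forall x e j l t p, encodes k c N rk s pz e j l t p ->
    sat (S := S) e (at_cell x j l) <-> Q x t p) ->
  (forall t p, t < extent k c N s -> p < extent k c N s ->
    ceval (binary N) (extent k c N s) Q d t p) ->
  model S (spectrum_sentence d).
Proof.
move=> hF hN Q_cell hQ; apply/model_closure => e; split.
  exact: (axioms_of_frame hF hN).
apply/sat_conjunction_map => -[j l] /allpairsP [[j' l'] []].
rewrite [_.1]/= [_.2]/= !mem_iota => hj hl [-> ->].
rewrite sat_imp => /(sat_domain _ hF) [a [b [ha hb hz]]].
have [t [p he]] : exists t p, encodes k c N rk s pz e j' l' t p.
  by do 2!eexists; exists a, b; split=> //; split=> //; lia.
apply/(sat_translate hF Q_cell d he).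
by have [] := encodes_lt (rank_lt (frame_rank hF)) he; apply: hQ.
Qed.

End Interpretation.

(** * The model built from a tableau *)

Section Standard.
Variables (n s : nat) (Q : K -> nat -> nat -> Prop).
Hypotheses (s0 : 0 < s) (hs : s * s <= n.+1).
Local Notation U := 'I_n.+1.

(** Notation in base [s], which fits because [s * s <= n.+1]. *)
Definition standard_pair (a b : nat) : U := inord (a * s + b).

(** [encodes] wants an assignment of all variables, so a cell relation quantifies over the
    extensions [e] of its arguments; by [encodes_fun] they all name the same cell. *)
Definition standard_interp (r : rel_symbol voc) (us : (arity r).-tuple U) : Prop :=
  let u i := nth ord0 us i in
  let len := trunc_log 2 n.+1 in
  match r with
  | inl LtS => u 0 < u 1
  | inl DigitS => u 0 < s
  | inl PairS => [/\ u 1 < s, u 2 < s & u 0 = standard_pair (u 1) (u 2)]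
  | inl DoubleS => u 1 = 2 * u 0 :> nat
  | inl PrefixS => u 0 <= len /\ (u 1).+1 = n.+1 %/ 2 ^ (len - u 0)
  | inr (x, (j, l)) => exists e t p, [/\ forall i, i < (2 * k).+1 -> e i = u i,
      encodes k c n.+1 val s standard_pair e j l t p & Q x t p]
  end.

Definition standard : structure voc := @Structure voc U standard_interp.

Lemma card_standard : #|universe standard| = n.+1.
Proof. exact: card_ord. Qed.

Lemma standard_frame : frame (S := standard) val s standard_pair.
Proof.
have nE (g : nat -> U) i : i < 5 ->
    nth ord0 [tuple g i | i < (2 * k).+1] i = g i.
  move=> hi; have hi' : i < (2 * k).+1 by lia.
  by rewrite -[i]/(nat_of_ord (Ordinal hi')) nth_mktuple.
have hab a b : a < s -> b < s -> a * s + b < n.+1 by move=> ha hb; nia.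
split=> //; rewrite ?card_standard.
- split=> [|u|u v]; [exact: val_inj|rewrite card_standard; exact: ltn_ord|].
  by rewrite /Lt /interp_nth /= !nE.
- by nia.
- by move=> u; rewrite /Digit /interp_nth /= nE.
- by move=> v a b; rewrite /Pair /interp_nth /= !nE.
- move=> a b a' b' ha hb ha' hb' /(congr1 val); rewrite /= !inordK ?hab //.
  by rewrite ![_ * s]mulnC ![_ * _ + _]addnC => /(radix_inj hb hb') [].
- by move=> u v; rewrite /Double /interp_nth /= !nE.
- by move=> u v; rewrite /Prefix /interp_nth /= !nE.
Qed.

Lemma standard_cell x e j l t p :
  encodes k c n.+1 val s standard_pair e j l t p ->
  sat (S := standard) e (at_cell x j l) <-> Q x t p.
Proof.
move=> he; have [a [b [[ha hj] [hb hl] _ _ _]]] := he.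
have hF := standard_frame.
rewrite sat_at_cell /interp_nth /= !inordK ?ltnS //.
have nE i : i < (2 * k).+1 -> nth ord0 [tuple e i | i < (2 * k).+1] i = e i.
  by move=> hi; rewrite -[i]/(nat_of_ord (Ordinal hi)) nth_mktuple.
split=> [[e' [t' [p' [hee he' hQ]]]]|hQ]; last first.
  by exists e, t, p; split=> // i hi; rewrite nE.
have hee' v : v < (2 * k).+1 -> e v = e' v by move=> hv; rewrite hee // nE.
by have [-> ->] := encodes_fun (frame_inj hF) hee' he he'.
Qed.

Lemma standard_model d :
  (forall t p, t < extent k c n.+1 s -> p < extent k c n.+1 s ->
    ceval (binary n.+1) (extent k c n.+1 s) Q d t p) ->
  model standard (spectrum_sentence d).
Proof.
move=> hQ; apply: (tableau_model (Q := Q) standard_frame); rewrite card_standard //.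
by move=> x e j l t p; apply: standard_cell.
Qed.

End Standard.

(** * Counting the variables *)

Local Notation b := (2 * k).+2.

Lemma bounded_atom r g : (forall i, i < (2 * k).+1 -> g i < b) ->
  bounded b (atom r g).
Proof.
move=> hg; apply/(@all_tnthP _ _ _ [tuple g i | i < (2 * k).+1]) => i.
by rewrite tnth_mktuple; apply: hg.
Qed.

Lemma bounded_lt u v : u < b -> v < b -> bounded b (lt u v).
Proof. by move=> hu hv; apply: bounded_atom => -[|[|i]]. Qed.
Lemma bounded_digit u : u < b -> bounded b (digit u).
Proof. by move=> hu; apply: bounded_atom. Qed.
Lemma bounded_pair u v v' : u < b -> v < b -> v' < b -> bounded b (pair u v v').
Proof. by move=> hu hv hv'; apply: bounded_atom => -[|[|[|i]]]. Qed.
Lemma bounded_double u v : u < b -> v < b -> bounded b (double u v).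
Proof. by move=> hu hv; apply: bounded_atom => -[|[|i]]. Qed.
Lemma bounded_prefix u v : u < b -> v < b -> bounded b (prefix u v).
Proof. by move=> hu hv; apply: bounded_atom => -[|[|i]]. Qed.
Lemma bounded_at_cell x j l : bounded b (at_cell x j l).
Proof. by apply: bounded_atom => i; apply: leqW. Qed.

Definition boundedE := (bounded_and, bounded_or, bounded_not, bounded_exists,
  bounded_imp, bounded_iff, bounded_eq, bounded_at_cell).

Lemma bounded_zero u v : u < b -> v < b -> bounded b (zero u v).
Proof. by move=> hu hv; rewrite !boundedE bounded_lt ?hu. Qed.
Lemma bounded_max u v : u < b -> v < b -> bounded b (max u v).
Proof. by move=> hu hv; rewrite !boundedE bounded_lt ?hu. Qed.
Lemma bounded_succ u v v' : u < b -> v < b -> v' < b -> bounded b (succ u v v').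
Proof. by move=> hu hv hv'; rewrite !boundedE !bounded_lt ?hu. Qed.

Lemma bounded_subst v r f : v < b ->
  bounded b (subst v r f) = bounded b r && bounded b f.
Proof. by move=> hv; rewrite !boundedE hv !ltnSn. Qed.

Lemma bounded_incr sw vs f g : all (gtn z) vs -> bounded b f -> bounded b g ->
  bounded b (incr sw vs f g).
Proof.
move=> + hf hg; elim: vs => [_|v vs IH].
  rewrite [incr _ _ _ _]/= bounded_or !bounded_subst ?hf ?hg ?andbT; try lia.
  by case: sw; rewrite /high_succ /high_wrap /high !boundedE
    !(bounded_pair, bounded_lt, bounded_digit); lia.
move=> /andP[hv /IH {}IH]; rewrite /= in hv.
rewrite (_ : incr sw (v :: vs) f g = Or (subst v (succ z v w) f)
  (max z v /&\ subst v (zero z w) (incr sw vs f g))) //.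
rewrite bounded_or bounded_and !bounded_subst ?IH ?hf; try lia.
by rewrite bounded_succ ?bounded_max ?bounded_zero //; lia.
Qed.

Lemma bounded_zeros vs : all (gtn z) vs -> bounded b (zeros vs).
Proof.
move=> /allP hvs; apply: bounded_conjunction => //; rewrite all_map.
by apply/allP => v /hvs /= hv; apply: bounded_zero; lia.
Qed.

Lemma bounded_high_zero sw : bounded b (high_zero sw).
Proof.
by case: sw; rewrite /high_zero /high !boundedE !(bounded_pair, bounded_lt); lia.
Qed.

Lemma bounded_bit b' : bounded b (bit b').
Proof.
by case: b'; rewrite /bit !boundedE !(bounded_prefix, bounded_double); lia.
Qed.

Lemma bounded_translate d j l : bounded b (translate d j l).
Proof.
have F : bounded b FFalse by [].
elim: d j l => [x|||b'|d IH|d IH|d IH|d IHd d' IHd'] j l; rewrite [translate _ _ _]/=.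
- exact: bounded_at_cell.
- case: ifP => // _; rewrite bounded_and bounded_high_zero bounded_zeros //.
  by apply/allP => x; rewrite mem_iota /=; lia.
- case: ifP => // _; rewrite bounded_and bounded_high_zero bounded_zeros //.
  by apply/allP => x; rewrite mem_iota /=; lia.
- case: ifP => // _; rewrite !bounded_and bounded_high_zero bounded_zeros ?bounded_bit //.
  by apply/allP => x; rewrite mem_iota /=; lia.
- apply: bounded_incr; [|exact: IH|by case: ifP].
  by apply/allP => x; rewrite mem_iota /=; lia.
- apply: bounded_incr; [|exact: IH|by case: ifP].
  by apply/allP => x; rewrite mem_iota /=; lia.
- by rewrite bounded_not IH.
by rewrite bounded_and IHd IHd'.
Qed.

Lemma bounded_spectrum_sentence d : bounded b (conjunction frame_axioms /&\
    conjunction [seq FImp (Exists 0 (Exists 1 (pair z 0 1)))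
                          (translate d jl.1 jl.2)
                | jl <- [seq (j, l) | j <- iota 0 c.+1, l <- iota 0 c.+1]]).
Proof.
rewrite bounded_and !bounded_conjunction //.
  rewrite all_map; apply/allP => -[j l] _ /=.
  by rewrite bounded_imp bounded_translate !boundedE bounded_pair; lia.
(* The largest index here is 5, and [5 < 2 * k + 2]. *)
rewrite /frame_axioms [all _ _]/= !boundedE
  !(bounded_lt, bounded_digit, bounded_pair, bounded_double, bounded_prefix); lia.
Qed.

End Sentence.

(** * Injectivity of the binary notation, and integer square roots *)

Lemma binary_inj N N' : 0 < N -> 0 < N' -> binary N = binary N' -> N = N'.
Proof.
move=> hN hN' h; have eL : trunc_log 2 N = trunc_log 2 N'.
  by have /eqP := congr1 size h; rewrite !size_binary eqSS => /eqP.
(* The prefixes of both numbers are compared, growing by one bit at a time up to the full number. *)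
suff E i : i <= trunc_log 2 N ->
    N %/ 2 ^ (trunc_log 2 N - i) = N' %/ 2 ^ (trunc_log 2 N - i).
  by have := E _ (leqnn _); rewrite subnn expn0 !divn1.
elim: i => [_|i IH hi].
  by rewrite subn0 divn_trunc_log // eL divn_trunc_log.
have S X : X %/ 2 ^ (trunc_log 2 N - i.+1) =
    odd (X %/ 2 ^ (trunc_log 2 N - i.+1)) + 2 * (X %/ 2 ^ (trunc_log 2 N - i)).
  rewrite (_ : trunc_log 2 N - i = (trunc_log 2 N - i.+1).+1); last lia.
  by rewrite expnSr divnMA divn2 mul2n odd_double_half.
rewrite S [RHS]S (IH (ltnW hi)) -(nth_binary hi); congr (nat_of_bool _ + _).
by rewrite eL -(@nth_binary N') -?eL // h.
Qed.

Lemma sqrt_exists N : exists s, s * s <= N < s.+1 * s.+1.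
Proof.
elim: N => [|N [s hs]]; first by exists 0.
by have [h|h] := ltnP N.+1 (s.+1 * s.+1); [exists s|exists s.+1]; nia.
Qed.

(** * The time bound *)

Section TimeBound.
Import Order.TTheory GRing.Theory Num.Theory.
Local Open Scope classical_set_scope.
Local Open Scope ring_scope.

(** The integer part of the exponent costs the factor [2 ^ k]. The half costs 3: the square of
    [2 ^ (n / 2)] is at most [2 * N], hence at most [2 * s ^ 2 + 4 * s], hence at most
    [9 * s ^ 2]. *)
Lemma powR_half_bound (R : realType) k n N s : (0 < s)%N -> (2 ^ n <= 2 * N)%N ->
  (N < s.+1 * s.+1)%N ->
  (2 : R) `^ ((k%:R + 2^-1) * n%:R) <= 2 ^+ k * 3 * (N ^ k * s)%:R.
Proof.
move=> s0 hn hs.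
rewrite mulrDl powRD; last by apply/implyP.
have -> : (2 : R) `^ (k%:R * n%:R) = (2 ^ n)%N%:R ^+ k.
  by rewrite mulrC powRrM powR_mulrn ?ler0n // powR_mulrn ?powR_ge0 // natrX.
set X := _ `^ (2^-1 * _).
have X0 : 0 <= X by apply: powR_ge0.
have XX : X ^+ 2 = (2 ^ n)%N%:R.
  rewrite expr2 /X -powRD; last by apply/implyP.
  by rewrite -mulrDl -[2^-1]div1r -splitr mul1r powR_mulrn ?ler0n // natrX.
have hX : X <= 3 * s%:R.
  rewrite -(ler_pXn2r (isT : (0 < 2)%N)) ?nnegrE ?mulr_ge0 ?ler0n // XX.
  by rewrite -[3]/(3%:R) -natrM -natrX ler_nat; nia.
have hk : ((2 ^ n)%N%:R : R) ^+ k <= 2 ^+ k * (N ^ k)%:R.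
  rewrite -[2]/(2%:R) -!natrX -natrM ler_nat -expnMn.
  by case: (k) => // k'; rewrite leq_exp2r.
apply: le_trans (ler_pM _ _ hk hX) _; rewrite ?exprn_ge0 //.
by rewrite natrM mulrACA mulrA.
Qed.

Lemma time_bound (R : realType) k (t : nat -> nat) :
  (fun n => (t n)%:R : R) =O_\oo
    (fun n : nat => (2 : R) `^ ((k%:R + 2^-1) * n%:R)) ->
  exists c, forall N s, (0 < N)%N -> (0 < s)%N -> (N < s.+1 * s.+1)%N ->
    (t (size (binary N)) < extent k c N s)%N.
Proof.
move=> /eqO_exP [C C0 [n0 _ hC]].
(* The sum takes care of the finitely many lengths below [n0], on which the asymptotic bound is
   silent; the first term rounds up the real constant. The factor [c.+1] in [extent] makes the
   inequality strict. *)
exists (Num.bound (C * (2 ^+ k * 3)) + \sum_(i < n0) t i)%N => N s hN s0 hs.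
have hX : (0 < N ^ k * s)%N by rewrite muln_gt0 expn_gt0 hN.
rewrite /extent mulnA; set X := (N ^ k * s)%N in hX *.
set b := Num.bound _; set n := size _; set S := (\sum_(i < n0) _)%N.
suff: (t n <= (b + S) * X)%N by rewrite mulnS; lia.
have [hn|hn] := ltnP n n0.
  have : (t n <= S)%N by rewrite /S (bigD1 (Ordinal hn)) //= leq_addr.
  by move: hX; clear; move: (t n) => y; nia.
suff: (t n <= b * X)%N by nia.
have h2n : (2 ^ n <= 2 * N)%N.
  rewrite /n size_binary expnS leq_mul2l /=.
  by have /andP[] := trunc_log_bounds (isT : (1 < 2)%N) hN.
have := hC n hn; rewrite /= normr_nat ger0_norm ?powR_ge0 // => hCn.
rewrite -(ler_nat R) natrM; apply: (le_trans hCn).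
apply: (@le_trans _ _ (C * (2 ^+ k * 3 * X%:R))).
  by rewrite ler_pM2l //; apply: powR_half_bound.
rewrite mulrA ler_wpM2r ?ler0n // ltW // archi_boundP //.
by rewrite mulr_ge0 ?mulr_ge0 ?exprn_ge0 // ltW.
Qed.

End TimeBound.

(** * From time-bounded machines to spectra *)

Local Open Scope classical_set_scope.

Theorem theorem4p1 (R : realType) (k : nat) (hk : 2 <= k) :
  NTIME (fun n : nat => ((2 : R) `^ ((k%:R + 2^-1) * n%:R))%R)
    `<=` SPEC (2 * k + 2).
Proof.
move=> A [Apos [M [t [hacc htime hO]]]].
have [c hc] := time_bound hO.
exists (voc k c (kind M)), (spectrum_sentence k c (tableau M)).
have hb := bounded_spectrum_sentence c hk (tableau M).
split; first exact: sentence_closure.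
  by rewrite addn2; apply: num_vars_closure.
have accP N : 0 < N -> A N <-> accepts M (binary N).
  move=> hN; split=> [hA|h].
    by have : [set w | accepts M w] (binary N) by rewrite hacc; exists N.
  have : [set w | accepts M w] (binary N) by [].
  by rewrite hacc => -[N' hA /(binary_inj (Apos _ hA) hN) <-].
apply/seteqP; split=> N.
  move=> hA; have hN := Apos _ hA; split=> //.
  have [s /andP[hs hs']] := sqrt_exists N.
  have s0 : 0 < s by case: s hs hs' => //; lia.
  have hT := hc N s hN s0 hs'.
  have [|m c' hm|Q hQ] := @tableau_complete M (binary N) (extent k c N s).
  - exact/accP.
  - exact: leq_ltn_trans (htime _ _ _ hm) hT.
  case: N hA hN hs hs' hT hQ => // n hA _ hs _ _ hQ.
  have hS := standard_model hk s0 hs hQ.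
  by eexists; split; last exact: hS; apply: card_standard.
move=> [hN [S [hS hm]]]; apply/accP => //; rewrite -hS in hN *.
(* This [s] is the one of the given model, possibly far below the square root; [tableau_sound]
   accepts any positive side. *)
have [s [Q [s0 hQ]]] := model_tableau hk hm hN.
apply: tableau_sound hQ.
by rewrite /extent !muln_gt0 expn_gt0 hN s0.
Qed.
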